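(* Let $u_L:[m]\times[n]\to[-1,1]$ be a learner payoff satisfying the standing assumptions, and let $\mathcal{M}\subseteq\Delta_{mn}$ be a polytopal no-regret asymptotic menu. Then $\mathcal{M}$ is Pareto-optimal if and only if $\mathcal{M}^-=\mathcal{M}^-_{NSR}$.
   Context: The optimizer has action set $[m]$ and the learner has action set $[n]$. $\Delta_k$ is the simplex over $[k]$; $\Delta_{mn}$ is the set of probability distributions over $[m]\times[n]$, whose elements are called correlated strategy profiles (CSPs). $x\otimes y$ is the product distribution. Payoffs $u_L,u_O:[m]\times[n]\to[-1,1]$ are extended (multi)linearly to $\Delta_m\times\Delta_n$ and to $\Delta_{mn}$. $\mathrm{BR}_L(x)=\arg\max_{j\in[n]}u_L(x,j)$. Standing assumptions on $u_L$: (1) there is a unique pair $(i^*,j^* )\in[m]\times[n]$ maximizing $u_L$; (2) the learner has no weakly dominated action, i.e. every $j\in[n]$ for which some $x\in\Delta_m$ has $j\in\mathrm{BR}_L(x)$ also admits some $x'\in\Delta_m$ with $\mathrm{BR}_L(x')=\{j\}$. Asymptotic menus. A learning algorithm $\mathcal{A}=\{A^T\}_{T\in\mathbb{N}}$ consists, for each horizon $T$, of functions $A^T_t:\Delta_m^{t-1}\to\Delta_n$; against $(x_1,\dots,x_T)\in\Delta_m^T$ the learner plays $y_t=A^T_t(x_1,\dots,x_{t-1})$. $\mathcal{M}(A^T)$ is the convex hull of all points $\frac1T\sum_{t=1}^T x_t\otimes y_t$ over all optimizer sequences. If $\mathcal{M}(A^1),\mathcal{M}(A^2),\dots$ converges in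 the Hausdorff metric, the (closed) limit is the asymptotic menu of $\mathcal{A}$. A subset of $\Delta_{mn}$ is an asymptotic menu if it arises this way from some learning algorithm. Pareto-optimality. For an asymptotic menu $\mathcal{M}$ and optimizer payoff $u_O$, $V_L(\mathcal{M},u_O)=\max\{u_L(\varphi)\mid\varphi\in\arg\max_{\varphi\in\mathcal{M}}u_O(\varphi)\}$. An asymptotic menu $\mathcal{M}'$ Pareto-dominates $\mathcal{M}$ if $V_L(\mathcal{M}',u_O)\ge V_L(\mathcal{M},u_O)$ for all $u_O:[m]\times[n]\to[-1,1]$, with strict inequality for at least one $u_O$. An asymptotic menu is Pareto-optimal if no asymptotic menu Pareto-dominates it. Regret. A CSP $\varphi$ is no-regret if $\sum_{i,j}\varphi_{ij}u_L(i,j)\ge\max_{j'\in[n]}\sum_{i,j}\varphi_{ij}u_L(i,j')$, and no-swap-regret if $\sum_i\varphi_{ij}u_L(i,j)\ge\max_{j'\in[n]}\sum_i\varphi_{ij}u_L(i,j')$ for each $j\in[n]$. $\mathcal{M}_{NR}$ and $\mathcal{M}_{NSR}$ are the convex hulls of all no-regret, respectively no-swap-regret, CSPs. An asymptotic menu $\mathcal{M}$ is no-regret if $\mathcal{M}\subseteq\mathcal{M}_{NR}$, and polytopal if it is the intersection of finitely many half-spaces. For a menu $\mathcal{M}$, $\mathcal{M}^-=\arg\min_{\varphi\in\mathcal{M}}u_L(\varphi)$ is the set of minimizers of $u_L$ over $\mathcal{M}$; $\mathcal{M}^-_{NSR}=(\mathcal{M}_{NSR})^-$. *)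

(* Defs.v *)
From mathcomp Require Import all_boot all_order all_algebra.
From mathcomp Require Import all_classical all_reals all_analysis.
Import numFieldNormedType.Exports.

Set Implicit Arguments.
Unset Strict Implicit.
Unset Printing Implicit Defensive.

Import Order.TTheory GRing.Theory Num.Theory.

Local Open Scope classical_set_scope.
Local Open Scope ring_scope.

Section Sets.
Context {R : realType}.

Definition argmax {T : Type} (f : T -> R) (A : set T) : set T :=
  [set x | A x /\ forall y, A y -> f y <= f x].

Definition argmin {T : Type} (f : T -> R) (A : set T) : set T :=
  [set x | A x /\ forall y, A y -> f x <= f y].

Definition conv_hull {V : lmodType R} (A : set V) : set V :=
  smallest (@convex_set R V) A.

Local Open Scope ereal_scope.

(* +oo between an empty and a nonempty set *)
Definition hausdorff_dist {X : pseudoMetricType R} (A B : set X) : \bar R :=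
  maxe (ereal_sup [set edist_inf B a | a in A])
       (ereal_sup [set edist_inf A b | b in B]).

End Sets.

Section Games.
Context {R : realType} {m n : nat}.

Definition simplex (k : nat) : set 'rV[R]_k :=
  [set x | (forall i, 0 <= x ord0 i) /\ \sum_i x ord0 i = 1].

Definition csp : set 'M[R]_(m, n) :=
  [set phi | (forall i j, 0 <= phi i j) /\ \sum_i \sum_j phi i j = 1].

Definition prod_csp (x : 'rV[R]_m) (y : 'rV[R]_n) : 'M[R]_(m, n) :=
  \matrix_(i, j) (x ord0 i * y ord0 j).

Definition bounded_payoff (u : 'M[R]_(m, n)) : Prop :=
  forall i j, -1 <= u i j <= 1.

Definition payoff (u phi : 'M[R]_(m, n)) : R :=
  \sum_i \sum_j phi i j * u i j.

(* u(x, j), the payoff of the mixed strategy x against the pure action j *)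
Definition mixed_payoff (u : 'M[R]_(m, n)) (x : 'rV[R]_m) (j : 'I_n) : R :=
  \sum_i x ord0 i * u i j.

Definition best_response (uL : 'M[R]_(m, n)) (x : 'rV[R]_m) : set 'I_n :=
  argmax (mixed_payoff uL x) setT.

Definition unique_max_profile (uL : 'M[R]_(m, n)) : Prop :=
  exists! p : 'I_m * 'I_n, forall i j, uL i j <= uL p.1 p.2.

Definition no_weakly_dominated (uL : 'M[R]_(m, n)) : Prop :=
  forall j, (exists2 x, simplex x & best_response uL x j) ->
    exists2 x', simplex x' & best_response uL x' = [set j].

(* [A T h] is the learner's mixed action in round [(size h).+1] of the game of
   horizon [T], when the optimizer has played [h] so far, oldest move first;
   the values of [A T] at histories of length at least [T] are never used. *)
Definition algorithm : Type := nat -> seq 'rV[R]_m -> 'rV[R]_n.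

Definition learning_algorithm (A : algorithm) : Prop :=
  forall T (h : seq 'rV[R]_m), (size h < T)%N ->
    (forall x, x \in h -> simplex x) -> simplex (A T h).

(* Rounds are numbered from 0. *)
Definition average_csp (A : algorithm) (T : nat) (x : T.-tuple 'rV[R]_m) :
    'M[R]_(m, n) :=
  T%:R^-1 *: \sum_(t < T) prod_csp (tnth x t) (A T (take t x)).

Definition menu (A : algorithm) (T : nat) : set 'M[R]_(m, n) :=
  conv_hull [set average_csp A x | x in
    [set x : T.-tuple 'rV[R]_m | forall t, simplex (tnth x t)]].

(* The distance on matrices is the entrywise sup distance; all norms on
   'M[R]_(m, n) give the same Hausdorff limits. *)
Definition asymptotic_menu_of (A : algorithm) (M : set 'M[R]_(m, n)) : Prop :=
  closed M /\ hausdorff_dist (menu A T) M @[T --> \oo] --> 0%E.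

Definition asymptotic_menu (M : set 'M[R]_(m, n)) : Prop :=
  M `<=` csp /\ exists2 A, learning_algorithm A & asymptotic_menu_of A M.

(* An asymptotic menu is compact and nonempty, so that the supremum is a
   maximum. *)
Definition learner_value (uL : 'M[R]_(m, n)) (M : set 'M[R]_(m, n))
    (uO : 'M[R]_(m, n)) : R :=
  sup [set payoff uL phi | phi in argmax (payoff uO) M].

Definition pareto_dominates (uL : 'M[R]_(m, n)) (M' M : set 'M[R]_(m, n)) :
    Prop :=
  (forall uO, bounded_payoff uO ->
     learner_value uL M uO <= learner_value uL M' uO) /\
  (exists2 uO, bounded_payoff uO &
     learner_value uL M uO < learner_value uL M' uO).

Definition pareto_optimal (uL : 'M[R]_(m, n)) (M : set 'M[R]_(m, n)) : Prop :=
  asymptotic_menu M /\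
  ~ exists2 M', asymptotic_menu M' & pareto_dominates uL M' M.

Definition no_regret (uL phi : 'M[R]_(m, n)) : Prop :=
  forall j', \sum_i \sum_j phi i j * uL i j' <= \sum_i \sum_j phi i j * uL i j.

Definition no_swap_regret (uL phi : 'M[R]_(m, n)) : Prop :=
  forall j j', \sum_i phi i j * uL i j' <= \sum_i phi i j * uL i j.

Definition menu_NR (uL : 'M[R]_(m, n)) : set 'M[R]_(m, n) :=
  conv_hull [set phi | csp phi /\ no_regret uL phi].

Definition menu_NSR (uL : 'M[R]_(m, n)) : set 'M[R]_(m, n) :=
  conv_hull [set phi | csp phi /\ no_swap_regret uL phi].

Definition no_regret_menu (uL : 'M[R]_(m, n)) (M : set 'M[R]_(m, n)) : Prop :=
  M `<=` menu_NR uL.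

Definition half_space (H : set 'M[R]_(m, n)) : Prop :=
  exists a b, a != 0 /\ H = [set phi | \sum_i \sum_j a i j * phi i j <= b].

Definition polytopal (M : set 'M[R]_(m, n)) : Prop :=
  exists (k : nat) (H : 'I_k -> set 'M[R]_(m, n)),
    (forall l, half_space (H l)) /\ M = \bigcap_l H l.

Definition min_part (uL : 'M[R]_(m, n)) (M : set 'M[R]_(m, n)) :
    set 'M[R]_(m, n) :=
  argmin (payoff uL) M.

End Games.

(* Main.v *)
(* A comparison of menus rests on one convexity fact: for menus [M1], [M2] with
   [V_L(M1, u) <= V_L(M2, u)] for all [u], the gap between the support functions
   of [M2] and [M1] is nondecreasing along every line [u + t u_L], because [V_L]
   is the derivative of the support function along that line.  As [t -> +oo] the
   gap vanishes when [M1] contains the unique maximizer of [u_L], whence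
   [M2 <= M1]; as [t -> -oo] it becomes nonnegative when [M1^-] is contained in
   [M2], whence [M1 <= M2].  Every no-regret menu contains [M_NSR], so a menu
   dominating an [M] with [M^- = M_NSR^-] is equal to [M].

   Conversely, [V_L(M, .)] takes finitely many values on a polytope [M].  If some
   [v] in [M^-] lies outside [M_NSR], cut [M] by a half-space that contains
   [M_NSR] and all points of [M] whose learner payoff exceeds the minimum by the
   smallest gap between these values, but not [v].  The cut loses no learner
   value and is a strictly smaller menu, hence dominates [M].  It is a menu by
   Blackwell approachability: the optimizer first announces a point of the set,
   both players then follow a plan for that point, and after any deviation the
   learner steers the average back to the set. *)
Require Import Defs.
From mathcomp Require Import all_boot all_order all_algebra.
From mathcomp Require Import all_classical all_reals all_analysis.
From mathcomp Require Import ring lra.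
Import numFieldNormedType.Exports.

Set Implicit Arguments.
Unset Strict Implicit.
Unset Printing Implicit Defensive.

Import Order.TTheory GRing.Theory Num.Theory.

Local Open Scope classical_set_scope.
Local Open Scope ring_scope.

(** * The payoff as an inner product on matrices *)

Section InnerProduct.
Context {R : realType} {m n : nat}.
Implicit Types (a b c : 'M[R]_(m, n)) (A S : set 'M[R]_(m, n)).

Lemma payoffE a b :
  payoff a b = \sum_(p : 'I_m * 'I_n) b p.1 p.2 * a p.1 p.2.
Proof. by rewrite /payoff pair_big. Qed.

Lemma payoffC a b : payoff a b = payoff b a.
Proof. by rewrite !payoffE; apply: eq_bigr => p _; rewrite mulrC. Qed.

Lemma payoffDr a b c : payoff a (b + c) = payoff a b + payoff a c.
Proof.
by rewrite !payoffE -big_split; apply: eq_bigr => p _; rewrite mxE mulrDl.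
Qed.

Lemma payoffZr a k b : payoff a (k *: b) = k * payoff a b.
Proof.
by rewrite !payoffE mulr_sumr; apply: eq_bigr => p _; rewrite mxE mulrA.
Qed.

Lemma payoffNr a b : payoff a (- b) = - payoff a b.
Proof. by rewrite -scaleN1r payoffZr mulN1r. Qed.

Lemma payoff0r a : payoff a 0 = 0.
Proof. by rewrite -(scale0r 0) payoffZr mul0r. Qed.

Lemma payoffDl a b c : payoff (a + b) c = payoff a c + payoff b c.
Proof. by rewrite payoffC payoffDr !(payoffC c). Qed.

Lemma payoffZl a k b : payoff (k *: a) b = k * payoff a b.
Proof. by rewrite payoffC payoffZr payoffC. Qed.

Lemma payoffNl a b : payoff (- a) b = - payoff a b.
Proof. by rewrite payoffC payoffNr payoffC. Qed.

Lemma payoff0l a : payoff 0 a = 0.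
Proof. by rewrite payoffC payoff0r. Qed.

Definition payoff_lin :=
  (payoffDl, payoffDr, payoffNl, payoffNr, payoffZl, payoffZr,
   payoff0l, payoff0r).

Lemma payoff_sqr_ge0 a : 0 <= payoff a a.
Proof. by rewrite payoffE; apply: sumr_ge0 => p _; rewrite -expr2 sqr_ge0. Qed.

Lemma coord_sqr_le a i j : a i j ^+ 2 <= payoff a a.
Proof.
rewrite payoffE (bigD1 (i, j)) //= -expr2 lerDl.
by apply: sumr_ge0 => p _; rewrite -expr2 sqr_ge0.
Qed.

Lemma payoff_sqr_gt0 a : a != 0 -> 0 < payoff a a.
Proof.
move=> a0; rewrite lt_neqAle payoff_sqr_ge0 andbT; apply: contra_neq a0 => e.
apply/matrixP => i j; rewrite mxE; apply/eqP.
by rewrite -sqrf_eq0 eq_le sqr_ge0 andbT e coord_sqr_le.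
Qed.

Lemma payoff_delta a i j : payoff a (delta_mx i j) = a i j.
Proof.
rewrite payoffE (bigD1 (i, j)) //= mxE !eqxx mul1r big1 ?addr0 // => -[k l].
by rewrite xpair_eqE mxE => /negbTE ->; rewrite mul0r.
Qed.

(** * Continuity of payoffs and compactness of sets of CSPs *)

Lemma sum_continuous (T : topologicalType) I (r : seq I) (f : I -> T -> R) :
  (forall i, continuous (f i)) -> continuous (fun x => \sum_(i <- r) f i x).
Proof.
move=> fc; elim: r => [|i r IHr] x.
  rewrite (_ : (fun _ => _) = cst 0); first exact: cst_continuous.
  by apply/funext => y; rewrite big_nil.
rewrite (_ : (fun _ => _) = (fun y => f i y + \sum_(i <- r) f i y)).
  by apply: cvgD; [exact: fc|exact: IHr].
by apply/funext => y; rewrite big_cons.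
Qed.

Lemma payoff_continuous a : continuous (payoff a).
Proof.
rewrite (_ : payoff a = fun b : 'M[R]_(m, n) => \sum_(p : 'I_m * 'I_n)
    b p.1 p.2 * a p.1 p.2); last by apply/funext => b; exact: payoffE.
apply: sum_continuous => p x; apply: continuousM.
  exact: coord_continuous.
exact: cst_continuous.
Qed.

Lemma payoff_sqr_continuous : continuous (fun a => payoff a a).
Proof.
under eq_fun do rewrite payoffE.
by apply: sum_continuous => p x; apply: continuousM; exact: coord_continuous.
Qed.

Lemma payoff_le_closed a (k : R) : closed [set b | payoff a b <= k].
Proof.
have /continuous_closedP ac := @payoff_continuous a.
exact: (ac _ (@closed_le R k)).
Qed.

Lemma box_compact : compact [set b : 'M[R]_(m, n) | forall i j, 0 <= b i j <= 1].
Proof.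
pose B := [set v : 'rV[R]_(m * n) | forall i, `[0, 1]%classic (v ord0 i)].
have Bc : compact B.
  apply: (@rV_compact R _ (fun=> `[0, 1]%classic)) => i; exact: segment_compact.
have vc : continuous (@vec_mx R m n).
  move=> v s /= /(nbhs_ballP _ _) [e e0 es].
  apply/(nbhs_ballP _ _); exists e => //= w [_ vw]; apply: es; split => // i j.
  by rewrite !mxE; exact: vw.
rewrite (_ : mkset _ = vec_mx @` B).
  by apply: continuous_compact => //; exact: continuous_subspaceT.
apply/seteqP; split=> [b bB|_ [v vB <-] i j].
  exists (mxvec b); last exact: mxvecK.
  by move=> k /=; rewrite in_itv; case/mxvec_indexP: k => i j; rewrite mxvecE; exact: bB.
by have := vB (mxvec_index i j); rewrite /= in_itv mxE.
Qed.

Lemma csp_entry_le1 a i j : csp a -> a i j <= 1.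
Proof.
move=> [a0 <-]; rewrite pair_big (bigD1 (i, j)) //= lerDl.
by apply: sumr_ge0 => p _; exact: a0.
Qed.

Lemma payoff_const1 a : payoff (const_mx 1) a = \sum_i \sum_j a i j.
Proof. by apply: eq_bigr => i _; apply: eq_bigr => j _; rewrite mxE mulr1. Qed.

Lemma csp_closed : closed (@csp R m n).
Proof.
rewrite (_ : csp = (\bigcap_(p : 'I_m * 'I_n)
    [set a : 'M[R]_(m, n) | payoff (- delta_mx p.1 p.2) a <= 0]) `&`
    ([set a | payoff (const_mx 1) a <= 1] `&`
     [set a | payoff (- const_mx 1) a <= -1])).
  apply: closedI; first by apply: closed_bigI => p _; exact: payoff_le_closed.
  by apply: closedI; exact: payoff_le_closed.
apply/seteqP; split=> a.
  move=> [a0 a1]; split=> [p _ /=|].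
    by rewrite payoffNl payoffC payoff_delta oppr_le0.
  by split; rewrite /= ?payoffNl payoff_const1 a1.
move=> [a0 /= [a1]]; rewrite payoffNl payoff_const1 lerN2 => a2; split=> [i j|].
  have /= := a0 (i, j) I; by rewrite payoffNl payoffC payoff_delta oppr_le0.
by apply/eqP; rewrite eq_le a2 -payoff_const1 a1.
Qed.

Lemma closed_csp_compact A : closed A -> A `<=` csp -> compact A.
Proof.
move=> Ac Acsp; apply: (subclosed_compact Ac box_compact) => a /Acsp aC i j /=.
by rewrite (csp_entry_le1 i j aC) andbT; case: aC.
Qed.

Lemma continuous_attains_max (f : 'M[R]_(m, n) -> R) A : continuous f -> compact A ->
  A !=set0 -> exists2 x, A x & forall y, A y -> f y <= f x.
Proof.
move=> fc Ac A0; have [x xA xmax] := compact_EVT_max A0 Ac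
  (continuous_subspaceT fc).
by exists x => [|y yA]; [exact: set_mem|apply/xmax/mem_set].
Qed.

Lemma argmax_payoff A u : compact A -> A !=set0 -> argmax (payoff u) A !=set0.
Proof.
move=> Ac A0; have [x xA xmax] := continuous_attains_max (@payoff_continuous u) Ac A0.
by exists x.
Qed.

(** * Convex sets, nearest points and separation *)

Definition convex A := forall (a b : 'M[R]_(m, n)) (t : R),
  A a -> A b -> 0 <= t -> t <= 1 -> A (t *: a + (1 - t) *: b).

Lemma convex_setP A : @convex_set R 'M[R]_(m, n) A <-> convex A.
Proof.
split=> Ac a b t.
  move=> aA bA t0 t1; apply: set_mem.
  have t01 : (0 <= t <= 1)%R by rewrite t0.
  have := Ac a b (Itv01 t0 t1) (mem_set aA) (mem_set bA).
  by [].
move=> /set_mem aA /set_mem bA; apply/mem_set.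
exact: (Ac a b t%:inum aA bA (ge0 t) (le1 t)).
Qed.

Lemma conv_hull_id A : convex A -> conv_hull A = A.
Proof. by move=> /convex_setP Ac; exact: smallest_id. Qed.

Lemma sub_conv_hull A : A `<=` conv_hull A.
Proof. exact: sub_gen_smallest. Qed.

Lemma conv_hull_sub A S : convex S -> A `<=` S -> conv_hull A `<=` S.
Proof. by move=> /convex_setP Sc; exact: smallest_sub. Qed.

Lemma convex_conv_hull A : convex (conv_hull A).
Proof.
move=> a b t aA bA t0 t1 S [/convex_setP Sc AS]; apply: (Sc) => //.
- by apply: aA; split=> //; exact/convex_setP.
- by apply: bA; split=> //; exact/convex_setP.
Qed.

Lemma csp_convex : convex (@csp R m n).
Proof.
move=> a b t [a0 a1] [b0 b1] t0 t1; split=> [i j|].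
  by rewrite !mxE addr_ge0 // mulr_ge0 // subr_ge0.
rewrite -payoff_const1 payoffDr !payoffZr !payoff_const1 a1 b1; lra.
Qed.

(* Minimizing [k |p|^2 - 2 <w, p>] rather than [|w - k p|^2] keeps the
   variational inequality meaningful for [k = 0]. *)
Lemma nearest_point S (w : 'M[R]_(m, n)) (k : R) : 0 <= k ->
  compact S -> convex S -> S !=set0 ->
  exists p, [/\ S p,
    forall q, S q -> payoff (w - k *: p) (q - p) <= 0 &
    forall q, S q -> payoff (w - k *: p) (w - k *: p) <=
                     payoff (w - k *: q) (w - k *: q)].
Proof.
move=> k0 Sc Scv S0.
pose G p := 2 * payoff w p - k * payoff p p.
have Gc : continuous G.
  move=> p; apply: (@continuousB _ _ _ (cst 2 \* payoff w)
    (cst k \* (fun a => payoff a a))); apply: continuousM.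
  - exact: cst_continuous.
  - exact: payoff_continuous.
  - exact: cst_continuous.
  - exact: payoff_sqr_continuous.
have [p pS pmax] := continuous_attains_max Gc Sc S0; exists p; split=> // q qS.
  rewrite leNgt; apply/negP; set V := payoff _ _ => V0.
  have Q0 := payoff_sqr_ge0 (q - p).
  set Q := payoff _ _ in Q0.
  have step t : 0 <= t -> t <= 1 -> 2 * V * t <= k * Q * t ^+ 2.
    move=> t0 t1; have := pmax _ (Scv _ _ _ qS pS t0 t1).
    rewrite /G /V /Q !payoff_lin !(payoffC q p); lra.
  have kQ0 : 0 <= k * Q by rewrite mulr_ge0.
  (* Moving from [p] toward [q] by [t] changes [G] by [2 V t - k Q t^2]. With this [t] one has
     [k Q t = V - V t < 2 V], so the change is positive, even when [k Q = 0]. *)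
  pose t := V / (V + k * Q).
  have D0 : 0 < V + k * Q by rewrite ltr_pwDl.
  have t0 : 0 < t by rewrite divr_gt0.
  have t1 : t <= 1 by rewrite ler_pdivrMr // mul1r lerDl.
  have := step t (ltW t0) t1; rewrite expr2 (mulrA (k * Q)) ler_pM2r //.
  have -> : k * Q * t = V - V * t by rewrite /t; field; rewrite gt_eqF.
  have : 0 < V * t by rewrite mulr_gt0.
  lra.
(* Since [|w - k p|^2 = |w|^2 - k G(p)], a maximizer of [G] minimizes this distance. *)
have := pmax _ qS; rewrite /G => /(ler_wpM2l k0).
rewrite !payoff_lin !(payoffC _ w); lra.
Qed.

Lemma separation S v : compact S -> convex S -> S !=set0 -> ~ S v ->
  exists2 u, u != 0 & exists2 k, payoff u v > k & forall q, S q -> payoff u q <= k.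
Proof.
move=> Sc Scv S0 vS; have [p [pS pV _]] := nearest_point v ler01 Sc Scv S0.
move: pV; rewrite scale1r => pV.
have vp : v - p != 0 by rewrite subr_eq0; apply: contra_notN vS => /eqP ->.
exists (v - p) => //; exists (payoff (v - p) p) => [|q /pV].
  by rewrite -subr_gt0 -payoffNr -payoffDr payoff_sqr_gt0.
by rewrite payoffDr payoffNr subr_le0.
Qed.

End InnerProduct.

(** * Comparing learner values *)

Lemma fin_pos_lower_bound (R : realType) (T : finType) (P : pred T)
    (s : T -> R) :
  (forall t, P t -> 0 < s t) ->
  exists2 e, 0 < e & forall t, P t -> e <= s t.
Proof.
move=> s0; exists (\big[Num.min/1]_(t | P t) s t).
  by elim/big_ind: _ => // x y x0 y0; rewrite lt_min x0.
by move=> t Pt; rewrite (bigD1 t) //= ge_min lexx.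
Qed.

Section LearnerValue.
Context {R : realType} {m n : nat}.
Variable uL : 'M[R]_(m, n).
Implicit Types (u a b : 'M[R]_(m, n)) (M : set 'M[R]_(m, n)).

Lemma payoff_csp_le u (k : R) a :
  (forall i j, u i j <= k) -> csp a -> payoff u a <= k.
Proof.
move=> uk [a0 a1]; rewrite -[leRHS]mul1r -a1 mulr_suml; apply: ler_sum => i _.
by rewrite mulr_suml; apply: ler_sum => j _; rewrite ler_wpM2l.
Qed.

Lemma payoff_csp_ge u (k : R) a :
  (forall i j, k <= u i j) -> csp a -> k <= payoff u a.
Proof.
move=> uk aC; rewrite -lerN2 -payoffNl; apply: payoff_csp_le => // i j.
by rewrite mxE lerN2.
Qed.

Lemma learner_valueP M u : compact M -> M !=set0 ->
  exists2 a, argmax (payoff u) M a & payoff uL a = learner_value uL M u /\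
    forall b, argmax (payoff u) M b -> payoff uL b <= learner_value uL M u.
Proof.
move=> Mc M0; have [c [cM cmax]] := argmax_payoff u Mc M0.
have Ac : compact (argmax (payoff u) M).
  rewrite (_ : argmax _ _ = M `&` [set b | payoff (- u) b <= - payoff u c]).
    by apply: compact_closedI => //; exact: payoff_le_closed.
  apply/seteqP; split=> b /= [bM bc]; split=> //.
    by rewrite payoffNl lerN2; exact: bc.
  by move=> d /cmax /le_trans; apply; move: bc; rewrite /= payoffNl lerN2.
have [|a [aA amax]] := argmax_payoff uL Ac; first by exists c.
have -> : learner_value uL M u = payoff uL a.
  apply/eqP; rewrite eq_le; apply/andP; split.
    by apply: ge_sup => [|_ [b bA <-]]; [exists (payoff uL a), a|exact: amax].
  apply: ub_le_sup; last by exists a.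
  by exists (payoff uL a) => _ [b bA <-]; exact: amax.
by exists a.
Qed.

Lemma learner_value_ge M u b : compact M -> argmax (payoff u) M b ->
  payoff uL b <= learner_value uL M u.
Proof.
move=> Mc bA; have M0 : M !=set0 by case: bA => bM _; exists b.
by have [a aA [_]] := learner_valueP u Mc M0; apply.
Qed.

Lemma learner_valueZ M u (c : R) : 0 < c ->
  learner_value uL M (c *: u) = learner_value uL M u.
Proof.
move=> c0; congr (sup (image _ _)); apply/seteqP.
by split=> a [aM amax]; split=> // b /amax; rewrite !payoffZl ler_pM2l.
Qed.

Lemma bounded_payoff_scale u : exists2 c, 0 < c & bounded_payoff (c *: u).
Proof.
have u1 : 0 < 1 + payoff u u by rewrite ltr_pwDl // payoff_sqr_ge0.
exists (1 + payoff u u)^-1; first by rewrite invr_gt0.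
move=> i j; rewrite mxE mulrC -ler_norml normrM normfV (gtr0_norm u1).
rewrite ler_pdivrMr // mul1r (le_trans _ (lerD (lexx 1) (coord_sqr_le u i j))) //.
rewrite -real_normK ?num_real //; set x := `|_|.
have := sqr_ge0 (x - 1); have : 0 <= x by exact: normr_ge0.
rewrite !expr2; nra.
Qed.

(** Learner values are invariant under positive rescaling of the optimizer's payoff. Dropping the
    bound matters because the lines [u + t u_L] leave the range [[-1, 1]]. *)
Lemma learner_value_le_unbounded M1 M2 :
  (forall u, bounded_payoff u -> learner_value uL M1 u <= learner_value uL M2 u) ->
  forall u, learner_value uL M1 u <= learner_value uL M2 u.
Proof.
move=> le12 u; have [c c0 cu] := bounded_payoff_scale u.
by rewrite -(learner_valueZ M1 u c0) -(learner_valueZ M2 u c0) le12.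
Qed.

(** The support function of [M]. *)
Definition top_value M u : R := sup (payoff u @` M).

Lemma top_valueE M u a : argmax (payoff u) M a -> top_value M u = payoff u a.
Proof.
move=> [aM amax]; apply/eqP; rewrite eq_le; apply/andP; split.
  by apply: ge_sup => [|_ [b bM <-]]; [exists (payoff u a), a|exact: amax].
by apply: ub_le_sup; [exists (payoff u a) => _ [b bM <-]; exact: amax|exists a].
Qed.

Lemma le_top_value M u a : compact M -> M a -> payoff u a <= top_value M u.
Proof.
move=> Mc aM; have [|b bA] := argmax_payoff u Mc; first by exists a.
by rewrite (top_valueE bA); exact: bA.2.
Qed.

Section Comparison.
Variables M1 M2 : set 'M[R]_(m, n).
Hypotheses (M1c : compact M1) (M2c : compact M2).
Hypotheses (M1csp : M1 `<=` csp) (M2csp : M2 `<=` csp).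
Hypotheses (M10 : M1 !=set0) (M20 : M2 !=set0).
Hypothesis uL_bounded : bounded_payoff uL.
Hypothesis le12 : forall u, learner_value uL M1 u <= learner_value uL M2 u.

Let D u := top_value M2 u - top_value M1 u.
Let t1 := learner_value uL M1.

Let t1_bound u : -1 <= t1 u <= 1.
Proof.
have [a [/M1csp aC _] [at1 _]] := learner_valueP u M1c M10.
rewrite /t1 -at1.
rewrite payoff_csp_ge ?payoff_csp_le // => i j.
- by case/andP: (uL_bounded i j).
- by case/andP: (uL_bounded i j).
Qed.

(* The learner's value is the derivative of the support function [top_value]
   in the direction [uL], so that [D] is nondecreasing in that direction; a
   Riemann sum replaces the integration of this derivative. *)
Let gap_step u (d : R) : 0 <= d ->
  D u + d * (t1 u - t1 (u + d *: uL)) <= D (u + d *: uL).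
Proof.
move=> d0; have [a2 a2A [a2v _]] := learner_valueP u M2c M20.
have [b1 b1A [b1v _]] := learner_valueP (u + d *: uL) M1c M10.
(* Each maximizer is tested at the other end of the step: [a2] bounds the growth of the support
   function of [M2] from below, [b1] that of [M1] from above. *)
have := le_top_value (u + d *: uL) M2c a2A.1.
have := le_top_value u M1c b1A.1.
rewrite /D (top_valueE a2A) (top_valueE b1A) !payoff_lin a2v b1v /t1.
have := ler_wpM2l d0 (le12 u); lra.
Qed.

(** The errors of the single steps telescope, so the total error is [d] times one difference of
    learner values, whatever the number of steps. *)
Let gap_steps u (d : R) k : 0 <= d ->
  D u + d * (t1 u - t1 (u + (k%:R * d) *: uL)) <= D (u + (k%:R * d) *: uL).
Proof.
move=> d0; elim: k => [|k IHk].
  by rewrite mul0r scale0r addr0 subrr mulr0 addr0.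
have := gap_step (u + (k%:R * d) *: uL) d0.
have -> : u + (k%:R * d) *: uL + d *: uL = u + (k.+1%:R * d) *: uL.
  by rewrite -addrA -scalerDl -natr1 mulrDl mul1r.
lra.
Qed.

Lemma top_value_gap_mono u (L : R) : 0 <= L ->
  top_value M2 u - top_value M1 u <=
  top_value M2 (u + L *: uL) - top_value M1 (u + L *: uL).
Proof.
move=> L0; rewrite -/(D u) -/(D (u + L *: uL)).
apply/ler_addgt0Pr => e e0.
(* Two learner values differ by at most 2, so steps of length [L / N] with [2 L / N < e] leave an
   error below [e]. *)
pose N := (Num.truncn (2 * L / e)).+1.
have N0 : (0 : R) < N%:R by rewrite ltr0n.
have Ne : 2 * L < e * N%:R.
  by rewrite -ltr_pdivrMl // mulrC truncnS_gt.
have d0 : 0 <= L / N%:R by rewrite divr_ge0 // ltW.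
have := gap_steps u N d0; rewrite mulrCA mulfV ?gt_eqF // mulr1.
have : 2 * (L / N%:R) < e by rewrite mulrA ltr_pdivrMr.
have /andP[] := t1_bound u; have /andP[] := t1_bound (u + L *: uL).
set d := L / _ in d0 *; nra.
Qed.

Lemma top_value_le_sub : (forall u, top_value M2 u <= top_value M1 u) ->
  convex M1 -> M2 `<=` M1.
Proof.
move=> le21 M1cv q qM; apply: contrapT => qM1.
have [u _ [k kq kM]] := separation M1c M1cv M10 qM1.
have [a aA] := argmax_payoff u M1c M10.
have := le_top_value u M2c qM; have := le21 u; have := kM _ aA.1.
rewrite (top_valueE aA); lra.
Qed.

(* Far in the direction [uL] every payoff is maximized at the profile (i, j). *)
Lemma dominating_sub i j : (forall k l, (k, l) != (i, j) -> uL k l < uL i j) ->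
  M1 (delta_mx i j) -> convex M1 -> M2 `<=` M1.
Proof.
move=> uLmax M1ij; apply: top_value_le_sub => u.
have [e e0 ele] : exists2 e, 0 < e & forall p : 'I_m * 'I_n,
    p != (i, j) -> e <= uL i j - uL p.1 p.2.
  by apply: fin_pos_lower_bound => -[k l] /uLmax; rewrite subr_gt0.
(* Every other profile loses at least [L * e] in the [uL] term, which covers all it can gain in
   [u]. *)
pose L := (\sum_(p : 'I_m * 'I_n) `|u p.1 p.2 - u i j|) / e.
have L0 : 0 <= L by rewrite divr_ge0 ?(ltW e0) // sumr_ge0.
have := top_value_gap_mono u L0.
suff : top_value M2 (u + L *: uL) <= top_value M1 (u + L *: uL) by lra.
have [a aA] := argmax_payoff (u + L *: uL) M2c M20.
rewrite (top_valueE aA); apply: le_trans (le_top_value _ M1c M1ij).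
rewrite payoff_delta; apply: payoff_csp_le (M2csp aA.1) => k l.
have [[-> ->] //|kl] := eqVneq (k, l) (i, j).
rewrite !mxE -lerBrDr -addrA -mulrBr -lerBlDl.
apply: (@le_trans _ _ (L * e)); last by rewrite ler_wpM2l // (ele (k, l)).
rewrite /L divfK ?gt_eqF // (bigD1 (k, l)) //= (le_trans (ler_norm _)) //.
by rewrite lerDl sumr_ge0.
Qed.

(** Points of [M1] that beat the best point [f] of [M1^-] by [e] in [u] form a compact set [K] on
    which [uL] stays away from its minimum. A large multiple of [- uL] makes them worse than [f],
    and [f] lies in [M2]. *)
Let top_value_low_limit u (e : R) : 0 < e -> min_part uL M1 `<=` M2 ->
  exists2 L, 0 <= L &
    top_value M1 (u - L *: uL) <= top_value M2 (u - L *: uL) + e.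
Proof.
move=> e0 min12; have [a0 [a0M a0min]] := argmax_payoff (- uL) M1c M10.
have {}a0min b : M1 b -> payoff uL a0 <= payoff uL b.
  by move=> /a0min; rewrite !payoffNl lerN2.
pose F := M1 `&` [set b | payoff uL b <= payoff uL a0].
have FE b : F b -> min_part uL M1 b.
  move=> [bM ba]; split=> // c cM.
  exact: (le_trans ba (a0min _ cM)).
have Fc : compact F by apply: compact_closedI => //; exact: payoff_le_closed.
have [|f [fF fmax]] := argmax_payoff u Fc.
  by exists a0; split=> //=.
have fM2 : M2 f by apply/min12/FE.
have fmin : payoff uL f = payoff uL a0.
  by apply/eqP; rewrite eq_le a0min ?andbT; [exact: fF.2|exact: fF.1].
pose K := M1 `&` [set b | payoff (- u) b <= - (payoff u f + e)].
have Kc : compact K by apply: compact_closedI => //; exact: payoff_le_closed.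
have main L : 0 <= L -> (forall b, K b -> payoff u b - L * payoff uL b <=
      payoff u f - L * payoff uL f) ->
    top_value M1 (u - L *: uL) <= top_value M2 (u - L *: uL) + e.
  move=> L0 Kle; have [b bA] := argmax_payoff (u - L *: uL) M1c M10.
  rewrite (top_valueE bA); have := le_top_value (u - L *: uL) M2c fM2.
  rewrite !payoff_lin; have [bK|bK] := pselect (K b).
    by have := Kle _ bK; lra.
  have : payoff u b < payoff u f + e.
    by rewrite ltNge; apply: contra_notN bK => bK; split;
      [exact: bA.1|rewrite /= payoffNl lerN2].
  have := ler_wpM2l L0 (a0min _ bA.1); rewrite fmin; lra.
have [K0|K0] := pselect (K !=set0); last first.
  by exists 0 => //; apply: main => // b bK; case: K0; exists b.
have [c [cK cmin]] := argmax_payoff (- uL) Kc K0.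
have cgt : payoff uL a0 < payoff uL c.
  rewrite lt_neqAle (a0min _ cK.1) andbT; apply/eqP => ac.
  have /fmax : F c by split; [exact: cK.1|rewrite /= ac].
  by move: cK.2; rewrite /= payoffNl; lra.
have [d [dK dmax]] := argmax_payoff u Kc K0.
pose L := (payoff u d - payoff u f) / (payoff uL c - payoff uL a0).
have den0 : 0 < payoff uL c - payoff uL a0 by rewrite subr_gt0.
have L0 : 0 <= L.
  by apply: divr_ge0; [|exact: ltW]; move: dK.2; rewrite /= payoffNl; lra.
exists L => //; apply: main => // b bK; have := dmax _ bK.
have : L * (payoff uL c - payoff uL a0) = payoff u d - payoff u f.
  by rewrite /L divfK // gt_eqF.
have cb : payoff uL c <= payoff uL b by have := cmin _ bK; rewrite !payoffNl; lra.
have := ler_wpM2l L0 cb; rewrite fmin; lra.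
Qed.

(** If [u] separates a point of [M1] from [M2], the gap of support functions is negative at [u]. By
    monotonicity it is at least as negative at [u - L *: uL], against the preceding bound with half
    the separation margin as error. *)
Lemma dominated_sub : min_part uL M1 `<=` M2 -> convex M2 -> M1 `<=` M2.
Proof.
move=> min12 M2cv q qM; apply: contrapT => qM2.
have [u _ [k kq kM]] := separation M2c M2cv M20 qM2.
have [a aA] := argmax_payoff u M2c M20.
have := le_top_value u M1c qM; have := kM _ aA.1; rewrite -(top_valueE aA).
have e0 : 0 < (payoff u q - k) / 2 by rewrite divr_gt0 // subr_gt0.
have [L L0] := top_value_low_limit u e0 min12.
have := top_value_gap_mono (u - L *: uL) L0; rewrite subrK; lra.
Qed.

End Comparison.
End LearnerValue.

(** * Regret *)

Section Convexity.
Context {R : realType} {m n : nat}.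
Implicit Types (a b : 'M[R]_(m, n)) (S : set 'M[R]_(m, n)).

Lemma convex_half_space a (k : R) : convex [set b | payoff a b <= k].
Proof.
move=> b c t /= bk ck t0 t1; rewrite !payoff_lin.
have := ler_wpM2l t0 bk; have : 0 <= 1 - t by lra.
move=> /ler_wpM2l /(_ _ _ ck); lra.
Qed.

Lemma convexI S1 S2 : convex S1 -> convex S2 -> convex (S1 `&` S2).
Proof. by move=> c1 c2 a b t [a1 a2] [b1 b2] t0 t1; split; [apply: c1|apply: c2]. Qed.

Lemma convex_bigcap I (F : I -> set 'M[R]_(m, n)) :
  (forall i, convex (F i)) -> convex (\bigcap_i F i).
Proof. by move=> Fc a b t aF bF t0 t1 i _; apply: Fc => //; [apply: aF|apply: bF]. Qed.

(** Points of weight zero may lie outside [S]; this admits conditional distributions given an event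
    of probability zero. *)
Lemma convex_sum S (I : eqType) (r : seq I) (w : I -> R) (p : I -> 'M[R]_(m, n)) :
  convex S -> (forall i, 0 <= w i) -> (forall i, 0 < w i -> S (p i)) ->
  0 < \sum_(i <- r) w i ->
  S ((\sum_(i <- r) w i)^-1 *: \sum_(i <- r) w i *: p i).
Proof.
move=> Sc w0 Sp; elim: r => [|i r IHr]; first by rewrite big_nil ltxx.
rewrite !big_cons => W0; have r0 : 0 <= \sum_(i <- r) w i by rewrite sumr_ge0.
have [rZ|r1] := eqVneq (\sum_(i <- r) w i) 0.
  have /allP rw0 : all (fun j => true ==> (w j == 0)) r.
    by rewrite -psumr_eq0 ?rZ.
  have -> : \sum_(j <- r) w j *: p j = 0.
    by rewrite big_seq big1 // => j /rw0 /eqP ->; rewrite scale0r.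
  move: W0; rewrite rZ !addr0 => wi; rewrite scalerA mulVf ?gt_eqF // scale1r.
  exact: Sp.
have {r1}r1 : 0 < \sum_(i <- r) w i by rewrite lt_neqAle eq_sym r1.
move: (IHr r1) => {}IHr; set W := \sum_(i <- r) w i in r0 r1 W0 IHr *.
have [wiZ|wi] := eqVneq (w i) 0; first by rewrite wiZ scale0r !add0r.
have {}wi : 0 < w i by rewrite lt_neqAle eq_sym wi w0.
have W1 : w i + W != 0 by rewrite gt_eqF.
have -> : (w i + W)^-1 *: (w i *: p i + \sum_(j <- r) w j *: p j) =
    (w i / (w i + W)) *: p i +
    (1 - w i / (w i + W)) *: (W^-1 *: \sum_(j <- r) w j *: p j).
  rewrite scalerDr !scalerA [_^-1 * _]mulrC; congr (_ + _ *: _).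
  by field; rewrite W1 gt_eqF.
apply: Sc => //; first exact: Sp; first by rewrite divr_ge0 // ltW.
by rewrite ler_pdivrMr // mul1r lerDl.
Qed.

End Convexity.

Section Regret.
Context {R : realType} {m n : nat}.
Variable uL : 'M[R]_(m, n).
Implicit Types (phi : 'M[R]_(m, n)) (S : set 'M[R]_(m, n)).

(** As an intersection of half-spaces, the set of no-regret CSPs is convex, so that the hull in
    [menu_NR] adds nothing. *)
Lemma no_regretE phi : no_regret uL phi <->
  forall j', payoff (\matrix_(i, j) uL i j' - uL) phi <= 0.
Proof.
have E j' : payoff (\matrix_(i, j) uL i j' - uL) phi =
    \sum_i \sum_j phi i j * uL i j' - payoff uL phi.
  rewrite payoffDl payoffNl; congr (_ - _).
  by apply: eq_bigr => i _; apply: eq_bigr => j _; rewrite mxE.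
by split=> nr j'; have := nr j'; rewrite E subr_le0.
Qed.

Lemma no_swap_regretE phi : no_swap_regret uL phi <-> forall jj : 'I_n * 'I_n,
  payoff (\matrix_(i, j) (if j == jj.1 then uL i jj.2 - uL i j else 0)) phi <= 0.
Proof.
have E j j' : payoff (\matrix_(i, l) (if l == j then uL i j' - uL i l else 0))
    phi = \sum_i phi i j * uL i j' - \sum_i phi i j * uL i j.
  rewrite -sumrB; apply: eq_bigr => i _; rewrite (bigD1 j) //= big1 => [|l lj].
    by rewrite mxE eqxx addr0 mulrBr.
  by rewrite mxE (negbTE lj) mulr0.
by split=> [ns [j j'] /=|ns j j']; [|have /= := ns (j, j')]; rewrite E subr_le0.
Qed.

Lemma menu_NRE : menu_NR uL = [set phi | csp phi /\ no_regret uL phi].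
Proof.
apply: conv_hull_id; apply: convexI; first exact: csp_convex.
rewrite (_ : no_regret uL = \bigcap_j'
    [set phi | payoff (\matrix_(i, j) uL i j' - uL) phi <= 0]).
  by apply: convex_bigcap => j'; exact: convex_half_space.
apply/seteqP; split=> phi; first by move=> /no_regretE nr j' _; exact: nr.
by move=> nr; apply/no_regretE => j'; exact: nr.
Qed.

Let nsr_bigcap : no_swap_regret uL = \bigcap_(jj : 'I_n * 'I_n) [set phi | payoff
  (\matrix_(i, j) (if j == jj.1 then uL i jj.2 - uL i j else 0)) phi <= 0].
Proof.
apply/seteqP; split=> phi; first by move=> /no_swap_regretE nr jj _; exact: nr.
by move=> nr; apply/no_swap_regretE => jj; exact: nr.
Qed.

Lemma menu_NSRE : menu_NSR uL = [set phi | csp phi /\ no_swap_regret uL phi].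
Proof.
apply: conv_hull_id; apply: convexI; first exact: csp_convex.
rewrite nsr_bigcap.
by apply: convex_bigcap => jj; exact: convex_half_space.
Qed.

Lemma convex_menu_NSR : convex (menu_NSR uL).
Proof. exact: convex_conv_hull. Qed.

Lemma compact_menu_NSR : compact (menu_NSR uL).
Proof.
rewrite menu_NSRE; apply: closed_csp_compact; last by move=> phi [].
apply: closedI; first exact: csp_closed.
change (closed (no_swap_regret uL)); rewrite nsr_bigcap.
by apply: closed_bigI => jj _; exact: payoff_le_closed.
Qed.

Lemma prod_cspP (x : 'rV[R]_m) (y : 'rV[R]_n) :
  simplex x -> simplex y -> csp (prod_csp x y).
Proof.
move=> [x0 x1] [y0 y1]; split=> [i j|]; first by rewrite mxE mulr_ge0.
rewrite -[RHS]x1; apply: eq_bigr => i _; rewrite -[RHS]mulr1 -y1 mulr_sumr.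
by apply: eq_bigr => j _; rewrite mxE.
Qed.

Lemma simplex_delta k (i : 'I_k) : simplex (delta_mx ord0 i : 'rV[R]_k).
Proof.
split=> [j|]; first by rewrite mxE ler0n.
by rewrite (bigD1 i) //= mxE !eqxx big1 ?addr0 // => j /negbTE ji; rewrite mxE ji.
Qed.

Lemma prod_delta (i : 'I_m) (j : 'I_n) :
  prod_csp (delta_mx ord0 i) (delta_mx ord0 j) = delta_mx i j :> 'M[R]_(m, n).
Proof. by apply/matrixP => k l; rewrite !mxE -natrM mulnb. Qed.

Lemma best_response_exists (x : 'rV[R]_m) (j0 : 'I_n) :
  exists j, best_response uL x j.
Proof.
exists [arg max_(j > j0) mixed_payoff uL x j]%O.
by case: arg_maxP => // j _ jmax; split=> // k _; exact: jmax.
Qed.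

Lemma payoff_prod u (x : 'rV[R]_m) (y : 'rV[R]_n) :
  payoff u (prod_csp x y) = \sum_j y ord0 j * mixed_payoff u x j.
Proof.
rewrite /payoff exchange_big; apply: eq_bigr => j _; rewrite mulr_sumr.
by apply: eq_bigr => i _; rewrite mxE -mulrA mulrCA.
Qed.

(** For a product profile, the regret toward a best response [k] is the [y]-average of the
    nonnegative losses relative to [k]. No regret forces every term of this average to vanish. *)
Lemma no_regret_support (x : 'rV[R]_m) (y : 'rV[R]_n) (j : 'I_n) :
  simplex y -> no_regret uL (prod_csp x y) ->
  y ord0 j != 0 -> best_response uL x j.
Proof.
move=> [y0 y1] nr yj; have [k [_ kmax]] := best_response_exists x j.
suff jk : mixed_payoff uL x j = mixed_payoff uL x k.
  by split=> // l _; rewrite jk kmax.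
pose g l := y ord0 l * (mixed_payoff uL x k - mixed_payoff uL x l).
have g0 l : 0 <= g l by rewrite mulr_ge0 // subr_ge0 kmax.
have gsum : \sum_l g l = 0.
  apply/eqP; rewrite eq_le sumr_ge0 ?andbT; last by [].
  have := nr k; rewrite -/(payoff uL _) payoff_prod.
  have -> : \sum_i \sum_l prod_csp x y i l * uL i k = mixed_payoff uL x k.
    apply: eq_bigr => i _; rewrite -[RHS]mul1r -y1 mulr_suml.
    by apply: eq_bigr => l _; rewrite mxE [x _ _ * _]mulrC mulrA.
  rewrite -subr_le0 => /(le_trans _); apply.
  rewrite /g; under eq_bigr do rewrite mulrBr.
  by rewrite sumrB -mulr_suml y1 mul1r.
have /eqP : g j = 0.
  by apply/eqP; rewrite eq_le g0 andbT -gsum (bigD1 j) //= lerDl sumr_ge0.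
by rewrite mulf_eq0 (negbTE yj) subr_eq0 => /eqP.
Qed.

Lemma no_regret_unique_response (x : 'rV[R]_m) (y : 'rV[R]_n) (j : 'I_n) :
  simplex y -> no_regret uL (prod_csp x y) ->
  best_response uL x = [set j] -> y = delta_mx ord0 j.
Proof.
move=> yS nr xj; have y0 l : l != j -> y ord0 l = 0.
  move=> lj; apply/eqP; apply: contraNT lj => /(no_regret_support yS nr).
  by rewrite xj => ->.
apply/rowP => l; rewrite mxE eqxx /=; have [->|/y0 //] := eqVneq l j.
by rewrite -yS.2 (bigD1 j) //= big1 ?addr0.
Qed.

Lemma prod_no_swap_regret (x : 'rV[R]_m) (y : 'rV[R]_n) : simplex y ->
  (forall j, y ord0 j != 0 -> best_response uL x j) ->
  no_swap_regret uL (prod_csp x y).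
Proof.
move=> yS br j j'.
have E k : \sum_i prod_csp x y i j * uL i k = y ord0 j * mixed_payoff uL x k.
  by rewrite mulr_sumr; apply: eq_bigr => i _; rewrite mxE -mulrA mulrCA.
rewrite !E; have [->|yj] := eqVneq (y ord0 j) 0; first by rewrite !mul0r.
by rewrite ler_wpM2l ?(yS.1 j) //; apply: (br j yj).2.
Qed.

Lemma prod_menu_NSR (x : 'rV[R]_m) (j : 'I_n) : simplex x ->
  best_response uL x j -> menu_NSR uL (prod_csp x (delta_mx ord0 j)).
Proof.
move=> xS xj; rewrite menu_NSRE; split.
  by apply: prod_cspP => //; exact: simplex_delta.
apply: prod_no_swap_regret; first exact: simplex_delta.
by move=> l; rewrite mxE eqxx /=; have [->|] := eqVneq l j; rewrite ?eqxx.
Qed.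

(* Conditioning a CSP on the learner's recommendation [j]. *)
Lemma menu_NSR_sub S : convex S -> (forall x j, simplex x ->
    best_response uL x j -> S (prod_csp x (delta_mx ord0 j))) ->
  menu_NSR uL `<=` S.
Proof.
move=> Sc Sp phi; rewrite menu_NSRE => -[[p0 p1] nsr].
pose c j := \sum_i phi i j.
pose x j : 'rV[R]_m := \row_i (phi i j / c j).
have c0 j : 0 <= c j by rewrite sumr_ge0.
have c1 : \sum_j c j = 1 by rewrite exchange_big.
have -> : phi = (\sum_j c j)^-1 *: \sum_j c j *: prod_csp (x j) (delta_mx ord0 j).
  rewrite c1 invr1 scale1r; apply/matrixP => i j; rewrite summxE (bigD1 j) //=.
  rewrite big1 => [|l lj]; last by rewrite !mxE eq_sym (negbTE lj) !mulr0.
  rewrite !mxE !eqxx mulr1 addr0 mulrC.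
  (* If [j] is recommended with probability zero, the quotient by [c j] carries no information, but
     the whole column of [phi] is zero. *)
  have [cj|cj] := eqVneq (c j) 0; last by rewrite divfK.
  rewrite cj mulr0; apply/eqP; rewrite eq_le p0 andbT -cj.
  by rewrite /c (bigD1 i) //= lerDl sumr_ge0.
apply: convex_sum => //; last by rewrite c1 ltr01.
move=> j cj; apply: Sp.
  split=> [i|]; first by rewrite mxE divr_ge0.
  by under eq_bigr do rewrite mxE; rewrite -mulr_suml divff // gt_eqF.
split=> // k _; have E l : mixed_payoff uL (x j) l = (\sum_i phi i j * uL i l) / c j.
  by rewrite mulr_suml; apply: eq_bigr => i _; rewrite mxE mulrAC.
by rewrite !E ler_pM2r ?invr_gt0.
Qed.

End Regret.

(** * Asymptotic menus *)

Section Hausdorff.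
Context {R : realType} {X : pseudoMetricType R}.
Implicit Types (A B : set X) (e : R).

Lemma hausdorff_dist_sym A B : hausdorff_dist A B = hausdorff_dist B A.
Proof. by rewrite /hausdorff_dist maxC. Qed.

Lemma hausdorff_dist_ball A B e a : (hausdorff_dist A B < e%:E)%E -> A a ->
  exists2 b, B b & ball a e b.
Proof.
rewrite /hausdorff_dist gt_max => /andP[AB _] aA.
have : (edist_inf B a < e%:E)%E.
  by apply: le_lt_trans AB; apply: ereal_sup_ubound; exists a.
move=> /ereal_inf_lt[_ [b bB <-]] /edist_lt_ball ab.
by exists b.
Qed.

Lemma hausdorff_dist_le A B e : 0 < e ->
  (forall a, A a -> exists2 b, B b & ball a e b) ->
  (forall b, B b -> exists2 a, A a & ball b e a) ->
  (hausdorff_dist A B <= e%:E)%E.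
Proof.
move=> e0 AB BA; rewrite /hausdorff_dist ge_max; apply/andP; split.
  apply: ge_ereal_sup => _ [a /AB[b bB ab] <-].
  apply: (@le_trans _ _ (edist (a, b))); last exact: edist_fin.
  by apply: ereal_inf_lbound; exists b.
apply: ge_ereal_sup => _ [b /BA[a aA ab] <-].
apply: (@le_trans _ _ (edist (b, a))); last exact: edist_fin.
by apply: ereal_inf_lbound; exists a.
Qed.

End Hausdorff.

Section AsymptoticMenu.
Context {R : realType} {m n : nat}.
Implicit Types (M : set 'M[R]_(m, n)) (A : @algorithm R m n).

Lemma asymptotic_menu_approx A M : asymptotic_menu_of A M ->
  forall e, 0 < e -> exists N, forall T, (N <= T)%N ->
    (forall a, menu A T a -> exists2 b, M b & ball a e b) /\
    (forall b, M b -> exists2 a, menu A T a & ball b e a).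
Proof.
move=> [_ cvg0] e e0.
have [N _ NT] : \forall T \near \oo, (hausdorff_dist (menu A T) M < e%:E)%E.
  apply: (cvg0 [set x | (x < e%:E)%E]); apply: open_nbhs_nbhs; split.
    exact: open_ereal_lt_ereal.
  by rewrite /= lte_fin.
exists N => T /NT /= dT; split=> [a|b]; first exact: hausdorff_dist_ball.
by apply: hausdorff_dist_ball; rewrite hausdorff_dist_sym.
Qed.

Lemma asymptotic_menu_ofI A M : closed M -> M !=set0 ->
  (forall e, 0 < e -> exists N, forall T, (N <= T)%N ->
    (forall a, menu A T a -> exists2 b, M b & ball a e b) /\
    (forall b, M b -> exists2 a, menu A T a & ball b e a)) ->
  asymptotic_menu_of A M.
Proof.
move=> Mc [c cM] approx; split=> //.
(* The point [c] gives the second supremum a nonnegative term; a supremum over the empty set would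
   be [-oo]. *)
have d0 T : (0 <= hausdorff_dist (menu A T) M)%E.
  rewrite /hausdorff_dist le_max; apply/orP; right.
  apply: (@le_trans _ _ (edist_inf (menu A T) c)); first exact: edist_inf_ge0.
  by apply: ereal_sup_ubound; exists c.
apply/fine_cvgP; split.
  have [N NT] := approx 1 ltr01; exists N => // T /NT [AM MA].
  rewrite ge0_fin_numE // (le_lt_trans (hausdorff_dist_le ltr01 AM MA)) //.
  exact: ltry.
apply/cvgrPdist_le => e e0; have [N NT] := approx e e0.
exists N => // T /NT [AM MA] /=; have := hausdorff_dist_le e0 AM MA.
rewrite sub0r normrN => de; rewrite ger0_norm ?fine_ge0 // -lee_fin fineK //.
by rewrite ge0_fin_numE // (le_lt_trans de) // ltry.
Qed.

Lemma asymptotic_menu_closed M : asymptotic_menu M -> closed M.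
Proof. by move=> [_ [A _ []]]. Qed.

Lemma asymptotic_menu_compact M : asymptotic_menu M -> compact M.
Proof.
by move=> Mm; apply: closed_csp_compact (asymptotic_menu_closed Mm) Mm.1.
Qed.

Lemma closed_approx M (a : 'M[R]_(m, n)) : closed M ->
  (forall e, 0 < e -> exists2 b, M b & ball a e b) -> M a.
Proof.
move=> Mc Ma; apply: Mc => B /(nbhs_ballP a)[e e0 eB].
by have [b bM ab] := Ma e e0; exists b; split=> //; exact: eB.
Qed.

Lemma ball_combination (a b c d : 'M[R]_(m, n)) (e t : R) : 0 <= t -> t <= 1 ->
  ball a e b -> ball c e d ->
  ball (t *: a + (1 - t) *: c) e (t *: b + (1 - t) *: d).
Proof.
move=> t0 t1 [e0 ab] [_ cd]; split=> // i j; rewrite /ball /= !mxE.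
have -> : t * a i j + (1 - t) * c i j - (t * b i j + (1 - t) * d i j) =
  t * (a i j - b i j) + (1 - t) * (c i j - d i j) by ring.
apply: le_lt_trans (ler_normD _ _) _.
have t0' : 0 <= 1 - t by rewrite subr_ge0.
rewrite !normrM (ger0_norm t0) (ger0_norm t0').
have abij : `|a i j - b i j| < e := ab i j.
have /ltW cdij : `|c i j - d i j| < e := cd i j.
have [->|tn0] := eqVneq t 0; first by rewrite mul0r add0r subr0 mul1r; exact: cd.
have {tn0}t0 : 0 < t by rewrite lt_neqAle eq_sym tn0.
have := ler_wpM2l t0' cdij; move: abij; rewrite -(ltr_pM2l t0); lra.
Qed.

(** Each [menu A T] is a convex hull, and convexity passes to a closed Hausdorff limit. *)
Lemma asymptotic_menu_convex M : asymptotic_menu M -> convex M.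
Proof.
move=> Mm a b t aM bM t0 t1; apply: closed_approx; first exact: asymptotic_menu_closed.
move=> e e0; have [A _ /asymptotic_menu_approx approx] := Mm.2.
have [N NT] := approx (e / 2) ltac:(by rewrite divr_gt0).
have [AM MA] := NT N (leqnn N).
have [a' a'A aa'] := MA a aM; have [b' b'A bb'] := MA b bM.
have [c cM cc] := AM _ (convex_conv_hull a'A b'A t0 t1).
exists c => //; rewrite [e]splitr; apply: ball_triangle cc.
exact: ball_combination.
Qed.

Lemma simplex_csp k : @simplex R k = @csp R 1 k.
Proof.
apply/seteqP; split=> x [x0 x1]; split.
- by move=> i j; rewrite (ord1 i).
- by rewrite big_ord1.
- by move=> i; exact: x0.
- by move: x1; rewrite big_ord1.
Qed.

Lemma simplex_compact k : compact (@simplex R k).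
Proof. by rewrite simplex_csp; apply: closed_csp_compact => //; exact: csp_closed. Qed.

Lemma average_simplex (T : nat) (y : 'I_T -> 'rV[R]_n) : (0 < T)%N ->
  (forall t, simplex (y t)) -> simplex (T%:R^-1 *: \sum_(t < T) y t).
Proof.
move=> T0 yS; have W : \sum_(t < T) (1 : R) = T%:R by rewrite sumr_const card_ord.
have : simplex ((\sum_(t < T) (1 : R))^-1 *: \sum_(t < T) 1 *: y t).
  rewrite simplex_csp; apply: convex_sum => [|//|t _|].
  - exact: csp_convex.
  - by rewrite -simplex_csp.
  - by rewrite W ltr0n.
by rewrite W; under eq_bigr do rewrite scale1r.
Qed.

Lemma prod_csp_linear (x : 'rV[R]_m) I (r : seq I) (y : I -> 'rV[R]_n) (c : R) :
  c *: \sum_(t <- r) prod_csp x (y t) = prod_csp x (c *: \sum_(t <- r) y t).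
Proof.
apply/matrixP => i j; rewrite !mxE !summxE [RHS]mulrCA; congr (_ * _).
by rewrite mulr_sumr; apply: eq_bigr => t _; rewrite mxE.
Qed.

(* The optimizer repeats [x] forever. *)
Lemma asymptotic_menu_response M (x : 'rV[R]_m) : asymptotic_menu M ->
  simplex x -> exists2 y, simplex y & M (prod_csp x y).
Proof.
move=> Mm xS; have [A Al /asymptotic_menu_approx approx] := Mm.2.
pose y T : 'rV[R]_n := T%:R^-1 *: \sum_(t < T) A T (take t (nseq T x)).
have yS T : (0 < T)%N -> simplex (y T).
  move=> T0; apply: average_simplex => // t; apply: Al.
    by rewrite size_take size_nseq ltn_ord.
  by move=> z /mem_take /nseqP[->].
have yM T : menu A T (prod_csp x (y T)).
  apply: sub_conv_hull; exists [tuple of nseq T x].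
    by move=> t /=; rewrite (tnth_nth x) nth_nseq if_same.
  rewrite /average_csp /y -prod_csp_linear; congr (_ *: _).
  by apply: eq_bigr => t _; rewrite (tnth_nth x) /= nth_nseq if_same.
(* The average responses [y T] need not converge; a cluster point is enough. *)
have [|l [lS lcl]] := @simplex_compact n (y @ \oo) _.
  by exists 1%N => // T T0; exact: yS.
exists l => //; apply: closed_approx; first exact: asymptotic_menu_closed.
move=> e e0; have [N NT] := approx (e / 2) ltac:(by rewrite divr_gt0).
have [||_ [[T NTT <-]]] := lcl (y @` [set T | (N <= T)%N]) (ball l (e / 2)).
- by exists N => // T /= NTT; exists T.
- by apply: (@nbhsx_ballx R); rewrite divr_gt0.
move=> [_ lT]; have [b bM Tb] := (NT T NTT).1 _ (yM T); exists b => //.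
rewrite [e]splitr; apply: ball_triangle Tb; move: (y T) lT => z lz; split=> [|i j].
  by rewrite divr_gt0.
rewrite /ball /= !mxE -mulrBr normrM ger0_norm ?xS.1 //.
apply: le_lt_trans (lz ord0 j); rewrite ler_piMl //.
by rewrite -xS.2 (bigD1 i) //= lerDl sumr_ge0 // => k _; exact: xS.1.
Qed.

Lemma asymptotic_menu_nonempty M (i : 'I_m) : asymptotic_menu M -> M !=set0.
Proof.
move=> Mm; have [y _ yM] := asymptotic_menu_response Mm (simplex_delta i).
by eexists; exact: yM.
Qed.

(* A weakly undominated best response is the unique one at mixed strategies
   arbitrarily close to the given one. *)
Lemma menu_NSR_sub_menu uL M : no_weakly_dominated uL -> asymptotic_menu M ->
  no_regret_menu uL M -> menu_NSR uL `<=` M.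
Proof.
move=> nwd Mm Mnr; apply: menu_NSR_sub (asymptotic_menu_convex Mm) _ => x j xS xj.
have [x' x'S x'j] : exists2 x', simplex x' & best_response uL x' = [set j].
  by apply: nwd; exists x.
have mixS t : 0 <= t -> t <= 1 -> simplex (t *: x' + (1 - t) *: x).
  by rewrite !simplex_csp in xS x'S *; exact: csp_convex.
(* Any positive weight on [x'] makes [j] the unique best response, so the no-regret response that
   [M] contains is the pure action [j]. *)
have mixM t : 0 < t -> t <= 1 ->
    M (prod_csp (t *: x' + (1 - t) *: x) (delta_mx ord0 j)).
  move=> t0 t1; have [y yS yM] := asymptotic_menu_response Mm (mixS t (ltW t0) t1).
  suff <- : y = delta_mx ord0 j by [].
  have := Mnr _ yM; rewrite menu_NRE => -[_ nr].
  apply: (no_regret_unique_response yS nr); apply/seteqP.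
  have E k : mixed_payoff uL (t *: x' + (1 - t) *: x) k =
      t * mixed_payoff uL x' k + (1 - t) * mixed_payoff uL x k.
    rewrite /mixed_payoff !mulr_sumr -big_split; apply: eq_bigr => i _ /=.
    by rewrite !mxE mulrDl !mulrA.
  have t1' : 0 <= 1 - t by lra.
  have [_ jmax'] : best_response uL x' j by rewrite x'j.
  have jmax k : mixed_payoff uL x k <= mixed_payoff uL x j by exact: xj.2.
  split=> k; last first.
    move=> ->; split=> // l _; rewrite !E.
    by apply: lerD; rewrite ler_wpM2l ?(ltW t0) // jmax'.
  move=> [_ /(_ j I)]; rewrite !E => kj.
  have : best_response uL x' k; last by rewrite x'j.
  split=> // l _; apply: le_trans (jmax' l I) _.
  rewrite -(ler_pM2l t0); have := ler_wpM2l t1' (jmax k); lra.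
apply: closed_approx; first exact: asymptotic_menu_closed.
(* The bound 1 keeps the mixture in the simplex; the bound [e / 2] keeps it within [e] of [x] in
   every entry. *)
move=> e e0; pose t := Num.min 1 (e / 2).
have t0 : 0 < t by rewrite lt_min ltr01 divr_gt0.
have t1 : t <= 1 by rewrite ge_min lexx.
have te : t < e.
  by rewrite (@le_lt_trans _ _ (e / 2)) ?ge_min ?lexx ?orbT // ltr_pdivrMr; lra.
eexists; first exact: (mixM t t0 t1).
split=> // i k; rewrite /ball /= !mxE -mulrBl normrM.
apply: le_lt_trans te; rewrite -[leRHS]mulr1; apply: ler_pM => //; last first.
  by rewrite normr_nat lern1; case: (_ && _).
have -> : x ord0 i - (t * x' ord0 i + (1 - t) * x ord0 i) =
  t * (x ord0 i - x' ord0 i) by ring.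
rewrite normrM gtr0_norm // -[leRHS]mulr1 ler_pM2l //.
have xle (z : 'rV[R]_m) : simplex z -> 0 <= z ord0 i <= 1.
  rewrite simplex_csp => zS; rewrite (csp_entry_le1 ord0 i zS) andbT.
  exact: zS.1.
have /andP[? ?] := xle _ xS; have /andP[? ?] := xle _ x'S.
by apply/ler_normlP; split; lra.
Qed.

End AsymptoticMenu.

(** * Approachability *)

Section Minimax.
Context {R : realType} {m n : nat}.
Variable B : 'M[R]_(m, n).

Let gain (y : 'rV[R]_n) i := \sum_j y ord0 j * B i j.
(** The positive part of [r], written with the norm so that its continuity is immediate. *)
Let pos (r : R) := (r + `|r|) / 2.

Let pos_ge0 r : 0 <= pos r.
Proof. by rewrite /pos; have := ler_norm (- r); rewrite normrN; lra. Qed.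

Let pos_ge r : r <= pos r.
Proof. by rewrite /pos; have := ler_norm r; lra. Qed.

Let pos_sqr_le (r s : R) : r <= s -> pos r ^+ 2 <= s ^+ 2.
Proof.
move=> rs; have [r0|r0] := leP 0 r.
  by rewrite /pos ger0_norm //; rewrite !expr2; nra.
by rewrite /pos ltr0_norm // subrr mul0r expr2 mul0r sqr_ge0.
Qed.

Let f (y : 'rV[R]_n) := \sum_i pos (gain y i) ^+ 2.

Let f_continuous : continuous f.
Proof.
have gc i : continuous (fun y => gain y i).
  apply: (@sum_continuous R _ _ _ (fun j (y : 'rV[R]_n) => y ord0 j * B i j)).
  move=> j y; apply: continuousM; last exact: cst_continuous.
  exact: coord_continuous.
have pc i : continuous (fun y => pos (gain y i)).
  move=> y; apply: (@continuousM _ _ (fun y => gain y i + `|gain y i|)).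
    apply: (@continuousD _ _ _ (fun y => gain y i) (fun y => `|gain y i|)).
      exact: gc.
    by apply: continuous_comp; [exact: gc|exact: norm_continuous].
  exact: cst_continuous.
apply: (@sum_continuous R _ _ _ (fun i y => pos (gain y i) ^+ 2)) => i y.
by apply: (@continuousM _ _ (fun y => pos (gain y i)) (fun y => pos (gain y i)));
  exact: pc.
Qed.

(* At a minimizer of [f], moving toward a response to the normalized vector of
   positive gains would decrease [f], unless that vector vanishes. *)
Lemma minimax_response (j0 : 'I_n) :
  (forall x, simplex x -> exists2 y, simplex y & payoff B (prod_csp x y) <= 0) ->
  exists2 y, simplex y & forall x, simplex x -> payoff B (prod_csp x y) <= 0.
Proof.
move=> resp.
have payE x y : payoff B (prod_csp x y) = \sum_i x ord0 i * gain y i.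
  apply: eq_bigr => i _; rewrite mulr_sumr; apply: eq_bigr => j _.
  by rewrite mxE mulrA.
have fNc : continuous (- f) by move=> y; apply: continuousN; exact: f_continuous.
have [|y yS ymax] := continuous_attains_max fNc (@simplex_compact R n).
  by exists (delta_mx ord0 j0); exact: simplex_delta.
have {}ymin z : simplex z -> f y <= f z by move=> /ymax; rewrite lerN2.
pose c i := pos (gain y i).
suff c0 i : c i = 0.
  exists y => // x xS; rewrite payE; apply: sumr_le0 => i _.
  by rewrite mulr_ge0_le0 ?xS.1 // -(c0 i) pos_ge.
have [cS|cS] := eqVneq (\sum_i c i) 0.
  apply/eqP; rewrite eq_le pos_ge0 andbT -cS (bigD1 i) //= lerDl sumr_ge0 //.
  by move=> k _; exact: pos_ge0.
have {}cS : 0 < \sum_i c i.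
  by rewrite lt_neqAle eq_sym cS sumr_ge0 // => k _; exact: pos_ge0.
have [|z zS] := resp (\row_i (c i / \sum_i c i)).
  split=> [k|]; first by rewrite mxE divr_ge0 ?pos_ge0 // ltW.
  by under eq_bigr do rewrite mxE; rewrite -mulr_suml divff // gt_eqF.
rewrite payE; under eq_bigr do rewrite mxE mulrAC.
rewrite -mulr_suml pmulr_lle0 ?invr_gt0 // => cz.
pose C := \sum_i c i ^+ 2; pose Z := \sum_i gain z i ^+ 2.
(* Replacing the gains of [y] by their positive parts [c] only increases the bound, and the cross
   term with [z] is nonpositive by [cz]. *)
have step t : 0 <= t -> t <= 1 -> C <= (1 - t) ^+ 2 * C + t ^+ 2 * Z.
  move=> t0 t1.
  have zt : simplex (t *: z + (1 - t) *: y).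
    by move: zS yS; rewrite !simplex_csp => zS yS; exact: csp_convex.
  apply: le_trans (ymin _ zt) _.
  apply: (@le_trans _ _ (\sum_i (t * gain z i + (1 - t) * c i) ^+ 2)).
    apply: ler_sum => k _; apply: pos_sqr_le.
    have -> : gain (t *: z + (1 - t) *: y) k = t * gain z k + (1 - t) * gain y k.
      rewrite /gain !mulr_sumr -big_split; apply: eq_bigr => j _ /=.
      by rewrite !mxE mulrDl !mulrA.
    by rewrite lerD2l ler_wpM2l ?subr_ge0 // pos_ge.
  have -> : \sum_i (t * gain z i + (1 - t) * c i) ^+ 2 =
     t ^+ 2 * Z + (2 * t * (1 - t)) * (\sum_i c i * gain z i) + (1 - t) ^+ 2 * C.
    rewrite !mulr_sumr -!big_split; apply: eq_bigr => k _ /=; ring.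
  have : 2 * t * (1 - t) * (\sum_i c i * gain z i) <= 0.
    by rewrite mulr_ge0_le0 // mulr_ge0 ?subr_ge0 // mulr_ge0.
  lra.
have Z0 : 0 <= Z by apply: sumr_ge0 => k _; exact: sqr_ge0.
have [C0|C0] := leP C 0.
  apply/eqP; rewrite -sqrf_eq0 eq_le sqr_ge0 andbT (le_trans _ C0) //.
  by rewrite /C (bigD1 i) //= lerDl sumr_ge0 // => k _; exact: sqr_ge0.
have CZ : 0 < C + Z by rewrite ltr_pwDl.
(* This [t] minimizes the right-hand side of [step]; the minimum [C Z / (C + Z)] is below [C] when
   [C > 0]. *)
pose t := C / (C + Z).
have t0 : 0 < t by rewrite divr_gt0.
have t1 : t <= 1 by rewrite ler_pdivrMr // mul1r lerDl.
have := step t (ltW t0) t1; have : t * (C + Z) = C by rewrite /t divfK // gt_eqF.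
have : 0 < t * C by rewrite mulr_gt0.
rewrite !expr2; nra.
Qed.

End Minimax.

(** * Realizing as a menu a closed convex set that answers every mixed strategy *)

Section Realization.
Context {R : realType} {m n : nat}.
Variable S : set 'M[R]_(m, n).
Hypotheses (Sclosed : closed S) (Sconvex : convex S) (Scsp : S `<=` csp).
Hypothesis S_response :
  forall x, simplex x -> exists2 y, simplex y & S (prod_csp x y).
Variables (i0 i1 : 'I_m) (j0 : 'I_n).
Hypothesis i01 : i0 != i1.
Implicit Types (W q phi : 'M[R]_(m, n)) (xs h : seq 'rV[R]_m).

Let Sc : compact S := closed_csp_compact Sclosed Scsp.

Let S0 : S !=set0.
Proof.
have [y _ yS] := S_response (simplex_delta i0).
by eexists; exact: yS.
Qed.

(** [W] stands for the total of [k] rounds. Comparing it with [k *: q], instead of dividing by [k],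
    covers the empty history. *)
Definition sqr_dist W (k : nat) q := payoff (W - k%:R *: q) (W - k%:R *: q).

(** For entries in [[0, 1]], [(a - b)^2 <= a + b], and each CSP sums to 1. *)
Lemma sqr_norm_csp_sub (a b : 'M[R]_(m, n)) : csp a -> csp b ->
  payoff (a - b) (a - b) <= 2.
Proof.
move=> aC bC; have -> : 2 = \sum_i \sum_j (a i j + b i j).
  under [RHS]eq_bigr do rewrite big_split; rewrite big_split /= aC.2 bC.2; ring.
apply: ler_sum => i _; apply: ler_sum => j _; rewrite !mxE.
have [a0 b0] := (aC.1 i j, bC.1 i j).
have a1 : 0 <= 1 - a i j by rewrite subr_ge0 csp_entry_le1.
have b1 : 0 <= 1 - b i j by rewrite subr_ge0 csp_entry_le1.
have := mulr_ge0 a0 a1; have := mulr_ge0 b0 b1; have := mulr_ge0 a0 b0; lra.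
Qed.

(** Blackwell's potential argument: the cross term is nonpositive, so a round adds at most
    [|z - q|^2 <= 2]. *)
Lemma sqr_dist_step W k q z : csp q -> csp z ->
  payoff (W - k%:R *: q) (z - q) <= 0 -> sqr_dist W k q <= 2 * k%:R ->
  sqr_dist (W + z) k.+1 q <= 2 * k.+1%:R.
Proof.
move=> qC zC; rewrite /sqr_dist.
have -> : W + z - k.+1%:R *: q = (W - k%:R *: q) + (z - q).
  by rewrite -natr1 scalerDl scale1r opprD addrACA.
move: (W - _) (z - q) (sqr_norm_csp_sub zC qC) => V d dd Vd VV.
rewrite payoffDl !payoffDr (payoffC d V) -natr1; lra.
Qed.

Definition blackwell_spec W (k : nat) : set 'rV[R]_n := [set y | simplex y /\
  exists p, [/\ S p, forall q, S q -> sqr_dist W k p <= sqr_dist W k q &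
    forall x, simplex x -> payoff (W - k%:R *: p) (prod_csp x y - p) <= 0]].

Definition blackwell_move W k : 'rV[R]_n := xget 0 (blackwell_spec W k).

(** The normal at the nearest point [p] defines a zero-sum game. Each [x] has a response inside [S],
    hence on the right side of the hyperplane through [p], and minimax yields one response for all
    [x]. *)
Lemma blackwell_moveP W k : blackwell_spec W k (blackwell_move W k).
Proof.
apply: xgetPex; have [p [pS pV pmin]] := nearest_point W (ler0n R k) Sc Sconvex S0.
(* On CSPs the constant matrix shifts the payoff so that the hyperplane through [p] becomes the zero
   level. *)
pose V := W - k%:R *: p; pose B := V - const_mx (payoff V p).
have BE x y : simplex x -> simplex y ->
    payoff B (prod_csp x y) = payoff V (prod_csp x y - p).
  move=> xS yS; have [_ sum1] := prod_cspP xS yS.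
  rewrite payoffDl payoffNl payoffDr payoffNr; congr (_ - _).
  have -> : const_mx (payoff V p) = payoff V p *: const_mx 1 :> 'M[R]_(m, n).
    by apply/matrixP => i j; rewrite !mxE mulr1.
  by rewrite payoffZl payoff_const1 sum1 mulr1.
have [|y yS yB] := @minimax_response R m n B j0.
  by move=> x xS; have [y yS yM] := S_response xS; exists y; rewrite ?BE ?pV.
by exists y; split=> //; exists p; split=> // x xS; rewrite -BE // yB.
Qed.

Fixpoint blackwell (k : nat) W h : 'rV[R]_n :=
  if h is x :: h' then blackwell k.+1 (W + prod_csp x (blackwell_move W k)) h'
  else blackwell_move W k.

(** Recursion on the optimizer's moves, instead of round indices, matches the fixpoints that define
    the strategies. *)
Fixpoint total (f : seq 'rV[R]_m -> 'rV[R]_n) xs : 'M[R]_(m, n) :=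
  if xs is x :: xs' then prod_csp x (f [::]) + total (fun h => f (x :: h)) xs'
  else 0.

Lemma totalE (f : seq 'rV[R]_m -> 'rV[R]_n) xs :
  \sum_(t < size xs) prod_csp (nth 0 xs t) (f (take t xs)) = total f xs.
Proof.
elim: xs f => [|x xs IHxs] f /=; first by rewrite big_ord0.
by rewrite big_ord_recl -IHxs.
Qed.

Lemma total_blackwell k W xs : {in xs, forall x, simplex x} ->
  (exists2 q, S q & sqr_dist W k q <= 2 * k%:R) ->
  exists2 q, S q & sqr_dist (W + total (blackwell k W) xs) (k + size xs) q
    <= 2 * (k + size xs)%:R.
Proof.
elim: xs k W => [|x xs IHxs] k W xsS [q qS qW] /=.
  by rewrite addr0 addn0; exists q.
have xS : simplex x by apply: xsS; rewrite mem_head.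
have [yS [p [pS pmin px]]] := blackwell_moveP W k.
rewrite addrA addnS -addSn; apply: IHxs.
  by move=> z zxs; apply: xsS; rewrite inE zxs orbT.
exists p => //; apply: sqr_dist_step; [exact: Scsp|exact: prod_cspP|exact: px|].
exact: le_trans (pmin _ qS) qW.
Qed.

(** Unlike squared distances, these entrywise errors add up when blocks of rounds are
    concatenated. *)
Definition near_multiple q W (k : nat) (e : R) :=
  forall i j, `|W i j - k%:R * q i j| <= e.

Definition rate (k : nat) : R := Num.sqrt (2 * k%:R).

Lemma sqr_dist_near q W k : sqr_dist W k q <= 2 * k%:R ->
  near_multiple q W k (rate k).
Proof.
move=> qW i j; rewrite -sqrtr_sqr ler_sqrt; last by rewrite mulr_ge0.
by apply: le_trans qW; have := coord_sqr_le (W - k%:R *: q) i j; rewrite !mxE.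
Qed.

Lemma rate_mono k l : (k <= l)%N -> rate k <= rate l.
Proof.
by move=> kl; rewrite ler_sqrt ?mulr_ge0 // ler_wpM2l // ler_nat.
Qed.

Lemma near_multipleD q W1 W2 k1 k2 (e1 e2 : R) :
  near_multiple q W1 k1 e1 -> near_multiple q W2 k2 e2 ->
  near_multiple q (W1 + W2) (k1 + k2) (e1 + e2).
Proof.
move=> n1 n2 i j; apply: le_trans (lerD (n1 i j) (n2 i j)).
apply: le_trans (ler_normD _ _); rewrite mxE natrD.
by rewrite (_ : _ - _ = W1 i j - k1%:R * q i j + (W2 i j - k2%:R * q i j)) //; ring.
Qed.

Lemma near_setD W1 W2 k1 k2 (e1 e2 : R) :
  (exists2 q, S q & near_multiple q W1 k1 e1) ->
  (exists2 q, S q & near_multiple q W2 k2 e2) ->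
  exists2 q, S q & near_multiple q (W1 + W2) (k1 + k2) (e1 + e2).
Proof.
move=> [q1 q1S n1] [q2 q2S n2].
have [k0|k0] := posnP (k1 + k2).
  exists q1 => //; apply: near_multipleD => // i j.
  by have := n2 i j; move/eqP: k0; rewrite addn_eq0 => /andP[_ /eqP ->]; rewrite !mul0r.
have k0' : (k1 + k2)%:R != 0 :> R by rewrite pnatr_eq0 -lt0n.
have e12 : 1 - k1%:R / (k1 + k2)%:R = k2%:R / (k1 + k2)%:R :> R.
  by rewrite natrD in k0' *; field.
(* The targets of the two blocks are averaged with weights proportional to the block lengths. *)
exists (k1%:R / (k1 + k2)%:R *: q1 + (1 - k1%:R / (k1 + k2)%:R) *: q2).
  apply: Sconvex => //.
  by rewrite ler_pdivrMr ?ltr0n // mul1r ler_nat leq_addr.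
move=> i j; apply: le_trans (lerD (n1 i j) (n2 i j)).
apply: le_trans (ler_normD _ _); rewrite e12 !mxE.
rewrite (_ : _ - _ = W1 i j - k1%:R * q1 i j + (W2 i j - k2%:R * q2 i j)) //.
by rewrite natrD in k0' *; field.
Qed.

Lemma near_one q z : csp q -> csp z -> near_multiple q z 1 1.
Proof.
move=> qC zC i j; have := qC.1 i j; have := zC.1 i j.
have := csp_entry_le1 i j qC; have := csp_entry_le1 i j zC.
by move=> *; apply/ler_normlP; split; lra.
Qed.

Lemma near_multiple_le q W k (e e' : R) : e <= e' ->
  near_multiple q W k e -> near_multiple q W k e'.
Proof. by move=> ee nq i j; apply: le_trans ee. Qed.

Lemma near_blackwell xs : {in xs, forall x, simplex x} ->
  exists2 q, S q & near_multiple q (total (blackwell 0 0) xs) (size xs) (rate (size xs)).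
Proof.
move=> xsS; have [|q qS qx] := @total_blackwell 0 0 xs xsS.
  by have [q qS] := S0; exists q => //; rewrite /sqr_dist scale0r subr0 payoff0l mulr0.
by exists q => //; move/sqr_dist_near: qx; rewrite add0r add0n.
Qed.

(* A pure profile that steers [W] toward [k *: phi]. *)
Definition plan_move phi (k : nat) W : 'I_m * 'I_n :=
  [arg min_(p < (i0, j0)) (W - k%:R *: phi) p.1 p.2]%O.

(** The smallest entry of a matrix is at most its average under [phi]. *)
Lemma plan_move_le phi k W : csp phi -> let p := plan_move phi k W in
  payoff (W - k%:R *: phi) (delta_mx p.1 p.2 - phi) <= 0.
Proof.
move=> phiC; rewrite /= /plan_move; case: arg_minP => //= p _ pmin.
rewrite payoffDr payoffNr payoff_delta subr_le0; apply: payoff_csp_ge => // i j.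
exact: (pmin (i, j)).
Qed.

Lemma csp_delta (i : 'I_m) (j : 'I_n) : csp (delta_mx i j : 'M[R]_(m, n)).
Proof. by rewrite -prod_delta; apply: prod_cspP; exact: simplex_delta. Qed.

Lemma plan_move_step phi k W : csp phi -> sqr_dist W k phi <= 2 * k%:R ->
  let p := plan_move phi k W in
  sqr_dist (W + delta_mx p.1 p.2) k.+1 phi <= 2 * k.+1%:R.
Proof.
move=> phiC Wk; apply: sqr_dist_step => //; first exact: csp_delta.
exact: plan_move_le.
Qed.

(** After the first deviation [blackwell] restarts from an empty total, so the deviating round is
    accounted for separately. *)
Fixpoint cooperate phi (k : nat) W h : 'rV[R]_n :=
  let p := plan_move phi k W in
  if h is x :: h' then
    if x == delta_mx ord0 p.1 then cooperate phi k.+1 (W + delta_mx p.1 p.2) h'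
    else blackwell 0 0 h'
  else delta_mx ord0 p.2.

Fixpoint plan phi (k : nat) W (T : nat) : seq 'rV[R]_m :=
  let p := plan_move phi k W in
  if T is T'.+1 then
    delta_mx ord0 p.1 :: plan phi k.+1 (W + delta_mx p.1 p.2) T'
  else [::].

Lemma size_plan phi k W T : size (plan phi k W T) = T.
Proof. by elim: T k W => //= T IHT k W; rewrite IHT. Qed.

Lemma plan_simplex phi k W T : {in plan phi k W T, forall x, simplex x}.
Proof.
elim: T k W => [|T IHT] k W x //=; rewrite inE => /orP[/eqP ->|/IHT //].
exact: simplex_delta.
Qed.

Lemma total_plan phi k W T : csp phi -> sqr_dist W k phi <= 2 * k%:R ->
  sqr_dist (W + total (cooperate phi k W) (plan phi k W T)) (k + T) phi
    <= 2 * (k + T)%:R.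
Proof.
move=> phiC; elim: T k W => [|T IHT] k W Wk /=; first by rewrite addr0 addn0.
rewrite prod_delta addrA addnS -addSn.
under [X in total X]eq_fun do rewrite eqxx.
by apply: IHT; exact: plan_move_step.
Qed.

(** One [rate] for the rounds on the plan, 1 for the deviating round and one [rate] for the approach
    to [S] after it. *)
Definition coop_rate (k : nat) : R := 1 + 2 * rate k.

Lemma total_cooperate phi k W xs : S phi -> {in xs, forall x, simplex x} ->
  sqr_dist W k phi <= 2 * k%:R ->
  exists2 q, S q & near_multiple q (W + total (cooperate phi k W) xs)
    (k + size xs) (coop_rate (k + size xs)).
Proof.
move=> phiS; have phiC := Scsp phiS.
have rate0 l : 0 <= rate l by exact: sqrtr_ge0.
elim: xs k W => [|x xs IHxs] k W xsS Wk /=.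
  rewrite addr0 addn0; exists phi => //.
  apply: near_multiple_le (sqr_dist_near Wk).
  by rewrite /coop_rate; have := rate0 k; lra.
have xS : simplex x by apply: xsS; rewrite mem_head.
have {}xsS : {in xs, forall z, simplex z}.
  by move=> z zxs; apply: xsS; rewrite inE zxs orbT.
set p := plan_move phi k W; have [xp|xp] := eqVneq x (delta_mx ord0 p.1).
  rewrite xp prod_delta addrA addnS -addSn.
  by apply: IHxs => //; exact: plan_move_step.
rewrite addrA addnS -addSn -(addn1 k) /coop_rate.
have [|q qS qn] := @near_setD (W + prod_csp x (delta_mx ord0 p.2)) _ (k + 1) _
    (rate k + 1) _ _ (near_blackwell xsS).
  exists phi => //; apply: near_multipleD; first exact: sqr_dist_near.
  apply: near_one => //; apply: prod_cspP => //; exact: simplex_delta.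
exists q => //; apply: near_multiple_le qn.
have := @rate_mono k (k + 1 + size xs); have := @rate_mono (size xs) (k + 1 + size xs).
rewrite leq_addl -addnA leq_addr => /(_ isT) + /(_ isT); lra.
Qed.

(* The optimizer announces the entries of [phi] one per round, as the weight it
   puts on [i0]. *)
Definition rounds := enum {: 'I_m * 'I_n}.

Definition decode (h : seq 'rV[R]_m) : 'M[R]_(m, n) :=
  \matrix_(i, j) nth 0 h (index (i, j) rounds) ord0 i0.

(** The second action [i1] carries the remaining weight, so that the weight on [i0] can be any
    number in [[0, 1]]. *)
Definition encode phi : seq 'rV[R]_m :=
  [seq phi p.1 p.2 *: delta_mx ord0 i0 + (1 - phi p.1 p.2) *: delta_mx ord0 i1
    | p <- rounds].

Lemma encodeK phi : decode (encode phi) = phi.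
Proof.
apply/matrixP => i j; have ij : (i, j) \in rounds by rewrite mem_enum.
rewrite mxE (nth_map (i, j)) ?index_mem // nth_index // !mxE !eqxx.
by rewrite (negbTE i01) mulr1 mulr0 addr0.
Qed.

Lemma encode_simplex phi : csp phi -> {in encode phi, forall x, simplex x}.
Proof.
move=> phiC _ /mapP[[i j] _ ->]; rewrite simplex_csp; apply: csp_convex.
- by rewrite -simplex_csp; exact: simplex_delta.
- by rewrite -simplex_csp; exact: simplex_delta.
- exact: phiC.1.
- exact: csp_entry_le1.
Qed.

Definition after_signal (acc h : seq 'rV[R]_m) : 'rV[R]_n :=
  if `[< S (decode acc) >] then cooperate (decode acc) 0 0 h else blackwell 0 0 h.

Fixpoint signal (K : nat) (acc h : seq 'rV[R]_m) : 'rV[R]_n :=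
  if K is K'.+1 then
    if h is x :: h' then signal K' (rcons acc x) h' else delta_mx ord0 j0
  else after_signal acc h.

(** Whatever the optimizer does, its play ends near [S]: each announcement round costs at most 1,
    and the later rounds are covered by [total_cooperate] or [near_blackwell]. *)
Lemma total_signal K acc xs : {in xs, forall x, simplex x} ->
  exists2 q, S q & near_multiple q (total (signal K acc) xs) (size xs)
    (K%:R + coop_rate (size xs)).
Proof.
have rate0 l : 0 <= rate l by exact: sqrtr_ge0.
elim: K acc xs => [|K IHK] acc xs xsS.
  rewrite add0r /= /after_signal; case: asboolP => accS.
    have [|q qS] := @total_cooperate _ 0 0 _ accS xsS.
      by rewrite /sqr_dist scale0r subr0 payoff0l mulr0.
    by rewrite add0r add0n => qn; exists q.
  have [q qS qn] := near_blackwell xsS; exists q => //.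
  by apply: near_multiple_le qn; rewrite /coop_rate; have := rate0 (size xs); lra.
case: xs xsS => [|x xs] xsS /=.
  have [q qS] := S0; exists q => // i j; rewrite mxE mul0r subrr normr0.
  by rewrite addr_ge0 // /coop_rate; have := rate0 0%N; lra.
have xS : simplex x by apply: xsS; rewrite mem_head.
have {}xsS : {in xs, forall z, simplex z}.
  by move=> z zxs; apply: xsS; rewrite inE zxs orbT.
have [|q qS qn] := @near_setD (prod_csp x (delta_mx ord0 j0)) _ 1 _ 1 _ _
    (IHK (rcons acc x) xs xsS).
  have [q qS] := S0; exists q => //; apply: near_one; first exact: Scsp.
  by apply: prod_cspP => //; exact: simplex_delta.
exists q => //; apply: near_multiple_le qn.
by have := rate_mono (leqnSn (size xs)); rewrite /coop_rate -natr1; lra.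
Qed.

(** Splits off the announcement, with total [J], to show that every point of [S] is nearly
    attained. *)
Lemma total_signal_cat phi acc ys zs : csp phi -> {in ys, forall x, simplex x} ->
  exists2 J, near_multiple phi J (size ys) (size ys)%:R &
    total (signal (size ys) acc) (ys ++ zs) = J + total (after_signal (acc ++ ys)) zs.
Proof.
move=> phiC; elim: ys acc => [|y ys IHys] acc ysS /=.
  exists 0; last by rewrite add0r cats0.
  by move=> i j; rewrite mxE mul0r subrr normr0.
have yS : simplex y by apply: ysS; rewrite mem_head.
have [|J Jn ->] := IHys (rcons acc y).
  by move=> z zxs; apply: ysS; rewrite inE zxs orbT.
exists (prod_csp y (delta_mx ord0 j0) + J); last by rewrite cat_rcons addrA.
rewrite -natr1 [_%:R + 1]addrC -(add1n (size ys)).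
apply: near_multipleD => //; apply: near_one => //.
by apply: prod_cspP => //; exact: simplex_delta.
Qed.

Let alg : algorithm := fun _ => signal (size rounds) [::].

Lemma learning_signal : learning_algorithm alg.
Proof.
move=> T h _ _; rewrite /alg; move: [::] (size rounds) => acc K.
have bS k W xs : simplex (blackwell k W xs).
  by elim: xs k W => [|x xs IHxs] k W //=; have [] := blackwell_moveP W k.
have cS phi k W xs : simplex (cooperate phi k W xs).
  elim: xs k W => [|x xs IHxs] k W /=; first exact: simplex_delta.
  by case: ifP.
elim: K acc h => [|K IHK] acc [|x h] //=; try exact: simplex_delta.
  by rewrite /after_signal; case: ifP.
by rewrite /after_signal; case: ifP.
Qed.

Lemma average_cspE T (x : T.-tuple 'rV[R]_m) :
  average_csp alg x = T%:R^-1 *: total (signal (size rounds) [::]) x.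
Proof.
rewrite /average_csp -totalE size_tuple; congr (_ *: _).
by apply: eq_bigr => t _; rewrite (tnth_nth 0).
Qed.

Lemma near_multiple_ball q W T (e e' : R) : (0 < T)%N -> e < e' * T%:R ->
  near_multiple q W T e -> ball (T%:R^-1 *: W) e' q.
Proof.
rewrite -(ltr0n R) => T0 ee nq.
have ball_ij i j : `|(T%:R^-1 *: W) i j - q i j| < e'.
  rewrite -(ltr_pM2r T0) (le_lt_trans _ ee) //; apply: le_trans (nq i j).
  rewrite -[X in _ * X]gtr0_norm // -normrM mxE mulrBl mulrAC mulVf ?gt_eqF //.
  by rewrite mul1r mulrC.
split=> //; exact: le_lt_trans (ball_ij i0 j0).
Qed.

Lemma rate_sublinear (K : nat) (e : R) : 0 < e ->
  exists N, forall T, (N <= T)%N -> (0 < T)%N /\ K%:R + coop_rate T < e * T%:R.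
Proof.
(* Once [rate T > B], both [K + 1 < rate T] and [8 < e * rate T] hold. As [rate T ^+ 2 = 2 T], the
   left side is then below [3 * rate T] and [e * T] is at least [4 * rate T]. *)
move=> e0; pose B := 8 / e + K%:R + 1.
have B0 : 0 < B by rewrite ltr_wpDl // addr_ge0 // divr_ge0 // ltW.
exists (Num.truncn (B ^+ 2)).+1 => T NT; split; first exact: leq_trans NT.
have BT : B ^+ 2 < T%:R.
  by apply: lt_le_trans (truncnS_gt _) _; rewrite ler_nat.
have sE : rate T ^+ 2 = 2 * T%:R by rewrite sqr_sqrtr // mulr_ge0.
have s0 : 0 <= rate T by exact: sqrtr_ge0.
have Bs : B < rate T.
  by rewrite -(ltr_pXn2r (n := 2)) ?nnegrE ?(ltW B0) // sE; have := ler0n R T; lra.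
rewrite /coop_rate; move: (rate T) sE s0 Bs => s sE s0 Bs.
have es : 8 < e * s.
  rewrite -ltr_pdivrMl // mulrC; apply: le_lt_trans Bs.
  by rewrite /B -addrA lerDl addr_ge0.
have Ks : K%:R + 1 < s by apply: le_lt_trans Bs; rewrite /B -addrA lerDr ltW // divr_gt0.
have : 8 * s <= e * s * s by rewrite ler_wpM2r // ltW.
have -> : e * s * s = e * (2 * T%:R) by rewrite -sE expr2 mulrA.
have := ler0n R K; lra.
Qed.

Lemma response_set_menu : asymptotic_menu S.
Proof.
split=> //; exists alg; first exact: learning_signal.
apply: asymptotic_menu_ofI => // e e0.
have [N NP] := rate_sublinear (size rounds) e0.
exists (N + size rounds)%N => T NT; have [] := NP T.
  exact: leq_trans (leq_addr _ _) NT.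
move=> T0 Te; split=> [a|phi phiS].
  (* This neighborhood of [S] is convex, so it suffices to treat the averages of single plays. *)
  pose near_S := [set a : 'M[R]_(m, n) | exists2 b, S b & ball a e b].
  apply: (@conv_hull_sub _ _ _ _ near_S) => {a} [a b t|_ [x xS <-]].
    move=> [a' a'S aa'] [b' b'S bb'] t0 t1.
    by exists (t *: a' + (1 - t) *: b'); [exact: Sconvex|exact: ball_combination].
  have xsS : {in (x : seq _), forall z, simplex z}.
    by move=> z /tnthP[t ->]; exact: xS.
  have [q qS qn] := total_signal (size rounds) [::] xsS.
  exists q => //; rewrite average_cspE; move: qn; rewrite size_tuple.
  exact: near_multiple_ball.
have KT : (size rounds <= T)%N by exact: leq_trans (leq_addl _ _) NT.
(* The optimizer announces [phi] and then follows the plan for the remaining rounds. *)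
have sz : size (encode phi ++ plan phi 0 0 (T - size rounds)) == T.
  by rewrite size_cat size_map size_plan subnKC.
exists (average_csp alg (Tuple sz)).
  apply: sub_conv_hull; exists (Tuple sz) => // t /=.
  have := mem_tnth t (Tuple sz); rewrite mem_cat => /orP[|].
    by apply: encode_simplex; exact: Scsp.
  exact: plan_simplex.
apply: ball_sym; rewrite average_cspE /=; apply: near_multiple_ball Te _ => //.
have [J Jn] := total_signal_cat [::] (plan phi 0 0 (T - size rounds)) (Scsp phiS)
  (encode_simplex (Scsp phiS)).
rewrite {1}size_map => ->; rewrite cat0s /after_signal encodeK asboolT //.
have TE : (size (encode phi) + (T - size rounds))%N = T.
  by rewrite size_map subnKC.
rewrite -[X in near_multiple _ _ X _]TE.
apply: near_multiple_le; last first.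
  apply: (near_multipleD Jn); apply: sqr_dist_near.
  have := @total_plan phi 0 0 (T - size rounds) (Scsp phiS).
  rewrite add0r add0n; apply.
  by rewrite /sqr_dist scale0r subr0 payoff0l mulr0.
rewrite size_map lerD2l /coop_rate.
have : 0 <= rate T by exact: sqrtr_ge0.
have := rate_mono (leq_subr (size rounds) T); lra.
Qed.

End Realization.

(** * Polytopal menus *)

Section Polytope.
Context {R : realType} {m n : nat}.
Implicit Types (M : set 'M[R]_(m, n)) (u : 'M[R]_(m, n)).

Lemma polytopalE M : polytopal M ->
  exists k (a : 'I_k -> 'M[R]_(m, n)) (b : 'I_k -> R),
    M = [set x | forall l, payoff (a l) x <= b l].
Proof.
move=> [k [H [Hhs ->]]]; exists k.
have /choice[ab abP] l : exists ab : 'M[R]_(m, n) * R,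
    H l = [set x | payoff ab.1 x <= ab.2].
  have [a [b [_ ->]]] := Hhs l; exists (\matrix_(i, j) a i j, b) => /=.
  suff aE x : payoff (\matrix_(i, j) a i j) x = \sum_i \sum_j a i j * x i j.
    by apply/seteqP; split=> x /=; rewrite aE.
  by apply: eq_bigr => i _; apply: eq_bigr => j _; rewrite mxE mulrC.
exists (fun l => (ab l).1), (fun l => (ab l).2).
by apply/seteqP; split=> x xH l => [|_]; have := xH l; rewrite abP //; apply.
Qed.

(* The learner's payoff is constant on the face cut out by the constraints
   that are tight at an optimal [x]: a point [z] of that face can be reflected
   slightly through [x] without leaving the polytope. Hence [learner_value]
   only takes finitely many values. *)
Lemma polytopal_value_gap uL M (mu : R) : compact M -> M !=set0 ->
  polytopal M -> (forall x, M x -> mu <= payoff uL x) ->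
  exists2 e, 0 < e & forall u,
    learner_value uL M u = mu \/ mu + e <= learner_value uL M u.
Proof.
move=> Mc M0 /polytopalE[k [a [b ME]]] Mmu.
pose face (I : {set 'I_k}) := M `&` [set x | forall l, l \in I -> payoff (a l) x = b l].
pose val I := sup (payoff uL @` face I).
have valP u : exists I, learner_value uL M u = val I.
  have [x [xM xmax] [xv vmax]] := learner_valueP uL u Mc M0.
  pose I := [set l | payoff (a l) x == b l]%SET; exists I.
  have xI : face I x by split=> // l; rewrite inE => /eqP.
  suff face1 z : face I z -> payoff uL z = payoff uL x.
    rewrite /val (_ : _ @` _ = [set payoff uL x]) ?sup1 //.
    by apply/seteqP; split=> [_ [z /face1 -> <-]|_ ->] //; exists x.
  move=> [zM zI].
  (* A step of length [d] away from [z] keeps every slack constraint satisfied; the 1 in the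
     denominator guards against division by zero. *)
  have [d d0 dle] : exists2 d, 0 < d & forall l, l \notin I ->
      d <= (b l - payoff (a l) x) / (1 + `|payoff (a l) (x - z)|).
    apply: fin_pos_lower_bound => l; rewrite inE => lI.
    apply: divr_gt0; last by rewrite ltr_pwDl.
    by rewrite subr_gt0 lt_neqAle lI; move: xM; rewrite ME; apply.
  pose w := x + d *: (x - z).
  have wM : M w.
    rewrite ME => l /=; rewrite payoffDr payoffZr.
    have [lI|lI] := boolP (l \in I).
      by rewrite payoffDr payoffNr zI // (xI.2 _ lI) subrr mulr0 addr0.
    have := dle l lI; rewrite ler_pdivlMr ?ltr_pwDl // mulrDr mulr1.
    have := ler_wpM2l (ltW d0) (ler_norm (payoff (a l) (x - z))); lra.
  have wE v : payoff v w = payoff v x + d * (payoff v x - payoff v z).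
    by rewrite payoffDr payoffZr payoffDr payoffNr.
  (* Since [x] lies strictly between [z] and [w] and maximizes [u], all three have the same
     [u]-payoff. So [z] and [w] are optimal too, and the same argument applies to [uL] among optimal
     points. *)
  have zu : payoff u z = payoff u x.
    apply/eqP; rewrite eq_le xmax //=; have := xmax _ wM.
    by rewrite wE gerDl pmulr_rle0 // subr_le0.
  apply/eqP; rewrite eq_le xv vmax /=; last by split=> // y; rewrite zu; exact: xmax.
  have : payoff uL w <= learner_value uL M u.
    by apply: vmax; split=> // y; rewrite wE zu subrr mulr0 addr0; exact: xmax.
  by rewrite -xv wE gerDl pmulr_rle0 // subr_le0.
have [e e0 ele] : exists2 e, 0 < e & forall I, mu < val I -> e <= val I - mu.
  by apply: fin_pos_lower_bound => I; rewrite subr_gt0.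
exists e => // u; have [I vI] := valP u.
have [x [xM _] [xv _]] := learner_valueP uL u Mc M0.
have := Mmu _ xM; rewrite xv le_eqVlt => /predU1P[<-|]; first by left.
by rewrite vI => /ele; right; lra.
Qed.

End Polytope.

(** * Characterization of Pareto-optimal polytopal no-regret menus *)

Theorem theorem4p1 (R : realType) (m n : nat) (uL : 'M[R]_(m, n))
  (uL_bounded : bounded_payoff uL)
  (uL_unique_max : unique_max_profile uL)
  (uL_not_dominated : no_weakly_dominated uL)
  (M : set 'M[R]_(m, n))
  (M_menu : asymptotic_menu M)
  (M_polytopal : polytopal M)
  (M_no_regret : no_regret_menu uL M) :
  pareto_optimal uL M <-> min_part uL M = min_part uL (menu_NSR uL).
Proof.
have [[i j] [/= ijmax ijuniq]] := uL_unique_max.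
have ijlt k l : (k, l) != (i, j) -> uL k l < uL i j.
  rewrite lt_neqAle ijmax andbT; apply: contra_neq => kl.
  by apply/esym/ijuniq => p q; rewrite kl.
have Mcsp : M `<=` csp := M_menu.1.
have Mc := asymptotic_menu_compact M_menu.
have M0 := asymptotic_menu_nonempty i M_menu.
have Mcv := asymptotic_menu_convex M_menu.
have NSR_M := menu_NSR_sub_menu uL_not_dominated M_menu M_no_regret.
have NSRij : menu_NSR uL (delta_mx i j).
  rewrite -prod_delta; apply: prod_menu_NSR; first exact: simplex_delta.
  have E l : mixed_payoff uL (delta_mx ord0 i) l = uL i l.
    rewrite /mixed_payoff (bigD1 i) //= mxE !eqxx mul1r big1 ?addr0 // => p pi.
    by rewrite mxE (negbTE pi) mul0r.
  by split=> // l _; rewrite !E.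
have [a0 [a0M a0max]] := argmax_payoff (- uL) Mc M0.
have {a0max} a0min x : M x -> payoff uL a0 <= payoff uL x.
  by move=> /a0max; rewrite !payoffNl lerN2.
split=> [[_ Mopt]|Mmin]; last first.
  split=> // -[M' M'_menu [le12 [u ub lt12]]].
  have M'c := asymptotic_menu_compact M'_menu.
  have M'0 := asymptotic_menu_nonempty i M'_menu.
  have le12' := learner_value_le_unbounded le12.
  have M'M : M' `<=` M.
    apply: (dominating_sub Mc M'c) ijlt _ Mcv => //; first exact: M'_menu.1.
    exact: NSR_M.
  (* As a subset of [M], the menu [M'] is no-regret too; with [menu_NSR] it contains the minimizers
     of [uL] on [M]. *)
  have NSR_M' : menu_NSR uL `<=` M'.
    by apply: menu_NSR_sub_menu => // x /M'M; exact: M_no_regret.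
  have MM' : M `<=` M'.
    apply: (dominated_sub Mc M'c) => //; last exact: asymptotic_menu_convex.
    by rewrite Mmin => x [/NSR_M'].
  have E : M = M' by apply/seteqP.
  by move: lt12; rewrite E ltxx.
apply: contrapT => Mmin.
have [v [vM vmin] vNSR] : exists2 v, min_part uL M v & ~ menu_NSR uL v.
  apply: contrapT => noV; apply: Mmin.
  have MN x : min_part uL M x -> menu_NSR uL x.
    by move=> xM; apply: contrapT => xN; apply: noV; exists x.
  apply/seteqP; split=> x xmin.
    by split=> [|y /NSR_M yM]; [exact: MN|exact: xmin.2].
  split=> [|y yM]; first exact: NSR_M _ xmin.1.
  by apply: le_trans (xmin.2 _ (MN a0 _)) (a0min y yM).
have NSRc := @compact_menu_NSR _ _ _ uL.
have [|h _ [k hv hk]] := separation NSRc (@convex_menu_NSR _ _ _ uL) _ vNSR.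
  by exists (delta_mx i j).
have [e e0 gap] := polytopal_value_gap Mc M0 M_polytopal vmin.
have [d [dM dmax]] := argmax_payoff h Mc M0.
(* Tilting [h] by [- L *: uL] makes a learner payoff of at least [e] above the minimum compensate
   any excess of [h] over [k] on [M]. At [v] there is nothing to compensate, so [v] is cut off. *)
pose L := (payoff h d - k) / e.
have hd : payoff h v <= payoff h d by exact: dmax.
have L0 : 0 <= L by rewrite divr_ge0 ?(ltW e0) // subr_ge0; lra.
have Le : L * e = payoff h d - k by rewrite /L divfK // gt_eqF.
pose M' := M `&` [set b | payoff (h - L *: uL) b <= k - L * payoff uL v].
have M'csp : M' `<=` csp by move=> x [/Mcsp].
have M'cl : closed M'.
  by apply: closedI; [exact: asymptotic_menu_closed|exact: payoff_le_closed].
have M'cv : convex M' by apply: convexI => //; exact: convex_half_space.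
have NSR_M' : menu_NSR uL `<=` M'.
  move=> q qN; have qM := NSR_M _ qN; split=> //=; rewrite !payoff_lin.
  have := ler_wpM2l L0 (vmin _ qM); have := hk _ qN; lra.
have high_M' x : M x -> payoff uL v + e <= payoff uL x -> M' x.
  move=> xM vx; split=> //=; rewrite !payoff_lin.
  have := ler_wpM2l L0 vx; have := dmax _ xM; rewrite mulrDr Le; lra.
have vM' : ~ M' v by move=> [_ /=]; rewrite !payoff_lin; lra.
(* The announcement needs two optimizer actions. With a single one every CSP is a product, for which
   no regret implies no swap regret, and [v] would lie in [menu_NSR]. *)
have [i1 ii1] : exists i1, i != i1.
  apply: contrapT => noi; apply: vNSR.
  have ii k' : k' = i.
    by apply/eqP; apply: contrapT => /negP ki; apply: noi; exists k'; rewrite eq_sym.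
  have vE : v = prod_csp (delta_mx ord0 i) (\row_l v i l).
    by apply/matrixP => p q; rewrite !mxE (ii p) !eqxx mul1r.
  have vC := Mcsp _ vM.
  have rS : simplex (\row_l v i l).
    split=> [l|]; first by rewrite mxE; exact: vC.1.
    rewrite -vC.2 (bigD1 i) //= [X in _ + X]big1 ?addr0.
      by apply: eq_bigr => l _; rewrite mxE.
    by move=> p; rewrite (ii p) eqxx.
  have := M_no_regret _ vM; rewrite menu_NRE menu_NSRE => -[_ vNR]; split=> //.
  rewrite vE; apply: prod_no_swap_regret => // l.
  by apply: no_regret_support rS _; rewrite -vE.
have M'_menu : asymptotic_menu M'.
  apply: (response_set_menu M'cl M'cv M'csp _ j ii1) => x xS.
  have [l xl] := best_response_exists uL x j.
  exists (delta_mx ord0 l); first exact: simplex_delta.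
  by apply: NSR_M'; exact: prod_menu_NSR.
have M'c := asymptotic_menu_compact M'_menu.
have M'0 := asymptotic_menu_nonempty i M'_menu.
have le12 u : learner_value uL M u <= learner_value uL M' u.
  have [x [xM xmax] [xv _]] := learner_valueP uL u Mc M0.
  (* Either the learner value on [M] is already the minimum over [M], which no point of [M']
     undercuts, or the optimal [x] survives the cut. *)
  case: (gap u) => [->|vx].
    by have [y [[yM _] _] [<- _]] := learner_valueP uL u M'c M'0; exact: vmin.
  rewrite -xv; apply: learner_value_ge => //; rewrite -xv in vx.
  by split=> [|y [/xmax]]; first exact: high_M'.
(* Without a strict improvement the two menus have equal learner values, and [dominating_sub] with
   the roles exchanged puts [M], hence [v], inside [M']. *)
apply: Mopt; exists M' => //; split=> //; apply: contrapT => nolt.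
apply: vM'; suff : M `<=` M' by exact.
apply: (dominating_sub M'c Mc) ijlt _ M'cv => //; last exact: NSR_M'.
apply: learner_value_le_unbounded => u ub; rewrite leNgt; apply/negP => lt12.
by apply: nolt; exists u.
Qed.
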